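(* Let $d\in\mathbb{N}$, $N\ge2$, and suppose the Assumption below holds with constants $C_d>0$, $p_d>0$. Then the cubature rule $Q_{d,N}$ defined below uses at most $N$ integration nodes and satisfies $$e^{\mathrm{wor}}(Q_{d,N};H_d)^2\le 2^{(p_d+2)(p_d+1)}(1+p_d)\Big(1+\frac{1}{p_d}\Big)^{p_d}\,C_d\,\frac{1}{N^{p_d+1}}.$$
   Context: Setting. $H_d$ is a separable, infinite-dimensional reproducing kernel Hilbert space of real-valued functions on $[0,1]^d$ with real reproducing kernel $K$ such that $M_{2,d}:=\int_{[0,1]^d}K(\mathbf{x},\mathbf{x})\,d\mathbf{x}<\infty$ and the embedding $H_d\hookrightarrow L_2([0,1]^d)$ is compact. The operator $W_d f=\int_{[0,1]^d}f(\mathbf{y})K(\cdot,\mathbf{y})\,d\mathbf{y}$ has eigenpairs $(\lambda_{d,j},\eta_{d,j})_{j\in\mathbb{N}}$ with $\lambda_{d,1}\ge\lambda_{d,2}\ge\cdots>0$ and $(\eta_{d,j})$ an orthonormal basis of $H_d$, orthogonal in $L_2$ with $\|\eta_{d,j}\|_{L_2}^2=\lambda_{d,j}$; put $\xi_{d,j}:=\eta_{d,j}/\sqrt{\lambda_{d,j}}$ and $u_m:=\frac1m\sum_{j=1}^m\xi_{d,j}^2$. $B_d\supset H_d$ is a separable Banach space of real functions on $[0,1]^d$, continuously embedded in $L_2([0,1]^d)$, with a zero-mean Gaussian measure $\mu_d$ satisfying $K(\mathbf{x},\mathbf{y})=\int_{B_d}f(\mathbf{x})f(\mathbf{y})\,d\mu_d(f)$.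 For $A\colon B_d\to L_2$, $e^{\mathrm{avg}}(A;\widetilde{\mathrm{App}}_d):=\big(\int_{B_d}\|f-Af\|_{L_2}^2d\mu_d(f)\big)^{1/2}$; for a cubature rule $Q$, $e^{\mathrm{avg}}(Q;\widetilde{\mathrm{Int}}_d):=\big(\int_{B_d}|\int_{[0,1]^d}f-Qf|^2d\mu_d(f)\big)^{1/2}$ and $e^{\mathrm{wor}}(Q;H_d):=\sup_{\|f\|_{H_d}\le1}|\int_{[0,1]^d}f-Qf|$. Also $e_{\mathrm{avg}}(m;\widetilde{\mathrm{App}}_d,\Lambda^{\mathrm{all}})^2:=\sum_{j>m}\lambda_{d,j}$. Assumption: $\sum_{j=m+1}^\infty\lambda_{d,j}\le C_d(m+1)^{-p_d}$ for all $m\in\mathbb{N}_0$. Building blocks. (i) For $m,q\in\mathbb{N}$, an algorithm $A_{d,s}$ using $s$ function values and points $\mathcal{P}=\{\mathbf{t}^{(1)},\ldots,\mathbf{t}^{(q)}\}$: $A_{d,s+q}(f;\mathcal{P},A_{d,s},m):=\sum_{j=1}^m\big(\langle A_{d,s}f,\xi_{d,j}\rangle_{L_2}+\frac1q\sum_{\ell=1}^q[f(\mathbf{t}^{(\ell)})-(A_{d,s}f)(\mathbf{t}^{(\ell)})]\frac{\xi_{d,j}(\mathbf{t}^{(\ell)})}{u_m(\mathbf{t}^{(\ell)})}\big)\xi_{d,j}$ ($0/0:=0$); for all such data there is a $q$-point $\mathcal{P}$ with $e^{\mathrm{avg}}(A_{d,s+q};\widetilde{\mathrm{App}}_d)^2\le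 e_{\mathrm{avg}}(m;\widetilde{\mathrm{App}}_d,\Lambda^{\mathrm{all}})^2+\frac mq e^{\mathrm{avg}}(A_{d,s};\widetilde{\mathrm{App}}_d)^2$. (ii) For an algorithm $A_{d,n}$ using $n$ function values and $\mathcal{P}=\{\mathbf{t}^{(1)},\ldots,\mathbf{t}^{(r)}\}$: $Q_{d,n+r}(f;\mathcal{P},A_{d,n}):=\int_{[0,1]^d}(A_{d,n}f)(\mathbf{x})d\mathbf{x}+\frac1r\sum_{\ell=1}^r\big(f(\mathbf{t}^{(\ell)})-(A_{d,n}f)(\mathbf{t}^{(\ell)})\big)$; for all such data there is an $r$-point $\mathcal{P}$ with $e^{\mathrm{avg}}(Q_{d,n+r};\widetilde{\mathrm{Int}}_d)^2\le\frac1r e^{\mathrm{avg}}(A_{d,n};\widetilde{\mathrm{App}}_d)^2$. Construction. Write $p=p_d$, $\omega(y):=y+y^{-p}$, $y_p:=p^{1/(p+1)}$, $\mathcal{K}_p:=\lfloor\log_2(2^{p+1}\omega(y_p)^{1+1/p})\rfloor$. Let $A_d^{(k)}:=0$ for $k\le\mathcal{K}_p$; for $k\ge\mathcal{K}_p$ let $m_k:=\lfloor(C_d2^k/e^{\mathrm{avg}}(A_d^{(k)};\widetilde{\mathrm{App}}_d)^2)^{1/(p+1)}y_p\rfloor$; for $k>\mathcal{K}_p$ let $A_d^{(k)}:=A_{d,2^k}(\cdot;\mathcal{P}_k,A_d^{(k-1)},m_{k-1})$ with $s=q=2^{k-1}$ and $\mathcal{P}_k$ a $2^{k-1}$-point set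 satisfying the bound in (i). With $\kappa:=\lfloor\log_2N\rfloor-1$, define $Q_{d,N}:=Q_{d,2^{\kappa+1}}(\cdot;\mathcal{P}^{\mathrm{int}},A_d^{(\kappa)})$, where $\mathcal{P}^{\mathrm{int}}$ is a $2^\kappa$-point set satisfying the bound in (ii) with $n=r=2^\kappa$. *)

(* Defs.v *)
From HB Require Import structures.
From mathcomp Require Import all_boot all_order all_algebra.
From mathcomp Require Import all_classical all_reals all_analysis.
Set Implicit Arguments. Unset Strict Implicit. Unset Printing Implicit Defensive.
Import Order.TTheory GRing.Theory Num.Def Num.Theory.
Import numFieldNormedType.Exports.
Local Open Scope classical_set_scope.
Local Open Scope ring_scope.

Definition cube {R : realType} (d : nat) : set (d.-tuple R) :=
  [set t | forall i : 'I_d, 0 <= tnth t i <= 1].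

(* Lebesgue integral over [0,1]^d, written as the iterated integral
   int_0^1 ... int_0^1 f(x_1,...,x_d) dx_d ... dx_1. *)
Fixpoint cube_int {R : realType} (d : nat) : (d.-tuple R -> \bar R) -> \bar R :=
  match d with
  | 0%N => fun f => f [tuple]
  | d'.+1 => fun f =>
      (\int[@lebesgue_measure R]_(x in `[0%R, 1%R])
          cube_int (fun t : d'.-tuple R => f (cons_tuple x t)))%E
  end.

Section Defs.
Context {R : realType} (d : nat).
Local Notation X := (d.-tuple R).

Definition rint (g : X -> R) : R := fine (cube_int (fun x => (g x)%:E)).
Definition L2dot (g h : X -> R) : R := fine (cube_int (fun x => (g x * h x)%:E)).

(* 0-indexed: lam j = lambda_{d,j+1}, eta j = eta_{d,j+1} *)
Definition xi (lam : nat -> R) (eta : nat -> X -> R) (j : nat) : X -> R :=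
  fun x => eta j x / Num.sqrt (lam j).

Definition u_m (lam : nat -> R) (eta : nat -> X -> R) (m : nat) : X -> R :=
  fun x => (m%:R)^-1 * \sum_(j < m) (xi lam eta j x) ^+ 2.

(* unit ball of H_d: functions sum_j c_j eta_j (pointwise on the cube)
   with sum_j c_j^2 <= 1, (eta_j) being an orthonormal basis of H_d *)
Definition H_ball (eta : nat -> X -> R) : set (X -> R) :=
  [set f | exists c : nat -> R,
      (forall n, \sum_(j < n) c j ^+ 2 <= 1) /\
      forall x, cube x ->
        (fun n => \sum_(j < n) c j * eta j x) @ \oo --> f x].

(* kernel representation K(x,y) = sum_j eta_j(x) eta_j(y) (reproducing kernel
   of the space with orthonormal basis (eta_j)) *)
Definition kernel_of_basis (K : X -> X -> R) (eta : nat -> X -> R) : Prop :=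
  forall x y, cube x -> cube y ->
    (fun n => \sum_(j < n) eta j x * eta j y) @ \oo --> K x y.

(* e_avg(m; App, Lambda^all)^2 = sum_{j>m} lambda_{d,j} *)
Definition eall (lam : nat -> R) (m : nat) : R :=
  limn (fun n => \sum_(m <= j < n) lam j).

Definition stepA (lam : nat -> R) (eta : nat -> X -> R) (P : seq X)
  (A : (X -> R) -> (X -> R)) (m : nat) : (X -> R) -> (X -> R) :=
  fun f x => \sum_(j < m)
     (L2dot (A f) (xi lam eta j)
      + (size P)%:R^-1 * \sum_(t <- P)
            (f t - A f t) * xi lam eta j t / u_m lam eta m t)
     * xi lam eta j x.

Definition cubQ (P : seq X) (A : (X -> R) -> (X -> R)) : (X -> R) -> R :=
  fun f => rint (A f) + (size P)%:R^-1 * \sum_(t <- P) (f t - A f t).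

Section AvgCase.
Context {dO : measure_display} {Omega : measurableType dO}
        (mu : probability Omega R) (F : Omega -> X -> R).
Definition eapp2 (A : (X -> R) -> (X -> R)) : \bar R :=
  (\int[mu]_w cube_int (fun x => ((F w x - A (F w) x) ^+ 2)%:E))%E.
Definition eint2 (Q : (X -> R) -> R) : \bar R :=
  (\int[mu]_w ((rint (F w) - Q (F w)) ^+ 2)%:E)%E.
End AvgCase.

Definition ewor (eta : nat -> X -> R) (Q : (X -> R) -> R) : \bar R :=
  ereal_sup [set (`| rint f - Q f |)%:E | f in H_ball eta].

End Defs.

Definition centered_gaussian_field {R : realType} (d : nat)
  {dO : measure_display} {Omega : measurableType dO} (mu : probability Omega R)
  (F : Omega -> d.-tuple R -> R) (K : d.-tuple R -> d.-tuple R -> R) : Prop :=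
  forall s : seq (R * d.-tuple R), (forall p, p \in s -> cube p.2) ->
    let Y := fun w => \sum_(p <- s) p.1 * F w p.2 in
    let v := \sum_(p <- s) \sum_(q <- s) p.1 * q.1 * K p.2 q.2 in
    measurable_fun setT Y /\
    forall A : set R, measurable A ->
      mu (Y @^-1` A) = if 0 < v then normal_prob 0 (Num.sqrt v) A
                       else \d_(0 : R) A.

Section Construction.
Context {R : realType}.
Definition omega_p (p y : R) : R := y + y `^ (- p).
Definition y_p (p : R) : R := p `^ (p + 1)^-1.
Definition K_p (p : R) : nat :=
  truncn (ln (2 `^ (p + 1) * omega_p p (y_p p) `^ (1 + p^-1)) / ln 2).
Definition m_k (C p : R) (e2 : \bar R) (k : nat) : nat :=
  truncn ((C * 2 ^+ k / fine e2) `^ (p + 1)^-1 * y_p p).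
Definition kappa (N : nat) : nat := (trunc_log 2 N).-1.
End Construction.

Fixpoint Alg {R : realType} (d : nat) {dO : measure_display}
  {Omega : measurableType dO} (mu : probability Omega R)
  (F : Omega -> d.-tuple R -> R) (lam : nat -> R) (eta : nat -> d.-tuple R -> R)
  (C p : R) (P : nat -> seq (d.-tuple R)) (k : nat)
  : (d.-tuple R -> R) -> (d.-tuple R -> R) :=
  match k with
  | 0%N => fun _ _ => 0
  | k'.+1 =>
      if (k'.+1 <= K_p p)%N then fun _ _ => 0
      else let A := Alg mu F lam eta C p P k' in
           stepA lam eta (P k'.+1) A (m_k C p (eapp2 mu F A) k')
  end.

Definition Q_N {R : realType} (d : nat) {dO : measure_display}
  {Omega : measurableType dO} (mu : probability Omega R)
  (F : Omega -> d.-tuple R -> R) (lam : nat -> R) (eta : nat -> d.-tuple R -> R)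
  (C p : R) (P : nat -> seq (d.-tuple R)) (Pint : seq (d.-tuple R)) (N : nat)
  : (d.-tuple R -> R) -> R :=
  cubQ Pint (Alg mu F lam eta C p P (kappa N)).

(* Main.v *)
Require Import Defs.
From HB Require Import structures.
From mathcomp Require Import all_boot all_order all_algebra.
From mathcomp Require Import all_classical all_reals all_analysis.
From mathcomp Require Import measurable_realfun ring lra.
Import Order.TTheory GRing.Theory Num.Def Num.Theory.
Import numFieldNormedType.Exports.
Local Open Scope classical_set_scope.
Local Open Scope ring_scope.

Set Implicit Arguments. Unset Strict Implicit. Unset Printing Implicit Defensive.

(** For a cubature rule [Q] with nodes in the cube the worst case error on the
    unit ball of [H_d] is at most the average case error: in the coordinates
    [Z_j = <F, eta_j> / lambda_j] of the Gaussian field [F], which are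
    orthonormal and satisfy [E[F(x) Z_j] = eta_j(x)], a function
    [f = sum_j c_j eta_j] is [f(x) = E[F(x) Z]] with [Z = sum_j c_j Z_j], so
    that [Int f - Q f = E[(Int F - Q F) Z]] and Cauchy-Schwarz applies.

    It remains to bound the errors [e_k] of the approximations [A^(k)].  With
    [r = (C 2^k / e_k)^(1/(p+1))] and [m_k = floor (r y_p)], step (i) gives
    [e_{k+1} <= C omega(y_p) r^(-p)], and [e_k <= C B 2^(-pk)] is invariant
    under this step for [B = (2^p omega(y_p))^(p+1)].  The definition of [K_p]
    says exactly that this bound also holds as long as [A^(k) = 0], where
    [e_k] is the trace of [K].  Dividing by [e_k] in [m_k] is harmless, because
    a method of finite rank misses some [Z_M] and hence has positive error. *)

(** * Second moment of a centered normal distribution *)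

Section integral_density.
Context d (T : measurableType d) (R : realType).
Variables (mu nu : {measure set T -> \bar R}) (g : T -> R).
Hypotheses (mg : measurable_fun [set: T] g) (g0 : forall x, 0 <= g x).
Hypothesis nuE : forall A, measurable A -> nu A = (\int[mu]_(x in A) (g x)%:E)%E.
Import HBNNSimple.

(** Indicators satisfy this by [nuE], simple functions by linearity, and nonnegative [f] by monotone
    convergence along simple approximations. *)
Lemma ge0_integral_density (f : T -> \bar R) :
  measurable_fun setT f -> (forall x, 0 <= f x)%E ->
  (\int[nu]_x f x = \int[mu]_x (f x * (g x)%:E))%E.
Proof.
move=> mf f0.
have mge : measurable_fun setT (fun x => (g x)%:E) by exact/measurable_EFinP.
pose f_ := nnsfun_approx measurableT mf.
have mf_ n : measurable_fun setT (fun x => (f_ n x)%:E).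
  exact/measurable_EFinP/measurable_funTS.
have ndf_ x : {homo (fun n => (f_ n x)%:E) : m n / (m <= n)%N >-> (m <= n)%E}.
  by move=> m n mn; rewrite lee_fin; exact/lefP/nd_nnsfun_approx.
transitivity (limn (fun n => \int[nu]_x (f_ n x)%:E))%E.
  rewrite -monotone_convergence//=.
  - apply: eq_integral => ? /[!inE] xD; apply/esym/cvg_lim => //=.
    exact: cvg_nnsfun_approx.
  - by move=> n x _; rewrite lee_fin.
transitivity (limn (fun n => \int[mu]_x ((f_ n x)%:E * (g x)%:E)))%E; last first.
  rewrite -monotone_convergence//=.
  - apply: eq_integral => x _; apply/cvg_lim => //.
    apply: cvgeZr => //; exact: cvg_nnsfun_approx.
  - by move=> n; exact: emeasurable_funM.
  - by move=> n x _; rewrite mule_ge0// lee_fin.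
  - by move=> x _ m n mn; rewrite lee_wpmul2r ?lee_fin// -lee_fin ndf_.
apply: congr_lim; apply/funext => n /=.
have fE x : ((f_ n x)%:E = \sum_(r \in range (f_ n))
    (r * \1_(f_ n @^-1` [set r]) x)%:E)%E by rewrite fimfunE -fsumEFin.
have mI r : measurable (f_ n @^-1` [set r]) by exact: measurable_sfunP.
have rI0 r x : (0 <= (r * \1_(f_ n @^-1` [set r]) x)%:E)%E.
  by rewrite EFinM nnfun_muleindic_ge0.
have mrI r : measurable_fun setT (fun x => (r * \1_(f_ n @^-1` [set r]) x)%:E).
  by apply/measurable_EFinP/measurable_funM => //; exact: measurable_indic.
under eq_integral do rewrite fE.
under [RHS]eq_integral do rewrite fE ge0_mule_fsuml//.
rewrite !ge0_integral_fsum//; last 2 first.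
- by move=> r; exact: emeasurable_funM.
- by move=> r x _; rewrite mule_ge0// lee_fin.
(* Only values [f_ n z] occur, so the constant to be pulled out of the integrals is nonnegative. *)
apply: eq_fsbigr => r /[!inE] -[z _ <-{r}].
have z0 : (0 <= (f_ n z)%:E)%E by rewrite lee_fin.
set r := f_ n z; set A := f_ n @^-1` [set r].
under eq_integral do rewrite EFinM.
have mA : measurable A by exact: mI.
rewrite ge0_integralZl//; last exact/measurable_EFinP/measurable_indic.
rewrite integral_indic// setIT nuE//.
under [RHS]eq_integral do rewrite EFinM -muleA.
rewrite ge0_integralZl//; last 2 first.
- apply: emeasurable_funM => //; exact/measurable_EFinP/measurable_indic.
- by move=> x _; rewrite mule_ge0// lee_fin.
congr (_ * _)%E; rewrite integral_mkcond; apply: eq_integral => x _.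
rewrite patchE indicE; case: ifPn => xA; first by rewrite mul1e.
by rewrite mul0e.
Qed.

End integral_density.

Section gaussian_second_moment.
Context {R : realType}.
Variable s : R.
Hypothesis s0 : s != 0.
Local Notation leb := (@lebesgue_measure R).
Local Notation pdf := (normal_pdf 0 s).

Lemma normal_pdf_even x : pdf (- x) = pdf x.
Proof. by rewrite !normal_pdfE// /normal_fun !subr0 sqrrN. Qed.

(** This is the boundary term of the integration by parts below. By [1 + u <= expR u] at
    [u = x^2 / (2 s^2)], [x * pdf x] is at most a constant times [1 / x]. *)
Lemma cvg_normal_pdf_id : (n%:R * pdf n%:R) @[n --> \oo] --> (0 : R).
Proof.
have s2 : 0 < s ^+ 2 by rewrite exprn_even_gt0.
have bd n : 0 <= n%:R * pdf n%:R <= normal_peak s * (s ^+ 2 *+ 2) * n%:R^-1.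
  rewrite mulr_ge0 ?normal_pdf_ge0//=; case: n => [|n].
    by rewrite mul0r invr0 mulr0.
  rewrite normal_pdfE// mulrCA -mulrA ler_wpM2l ?normal_peak_ge0//.
  rewrite /normal_fun subr0 mulNr expRN ler_pdivrMr ?expR_gt0//.
  set x : R := n.+1%:R; have x0 : 0 < x by rewrite ltr0n.
  have := expR_ge1Dx (x ^+ 2 / (s ^+ 2 *+ 2)).
  have c0 : 0 <= s ^+ 2 *+ 2 / x by rewrite divr_ge0 ?ltW// mulrn_wgt0.
  move=> /(ler_wpM2l c0); apply: le_trans; rewrite mulrDr mulr1 mulrA.
  rewrite [X in _ + X](_ : _ = x) ?lerDr//.
  by field; rewrite s0 gt_eqF.
apply: (@squeeze_cvgr _ _ _ _ (fun=> 0)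
  (fun n => normal_peak s * (s ^+ 2 *+ 2) * n%:R^-1)); first exact: nearW.
  exact: cvg_cst.
rewrite -[X in _ --> X](mulr0 (normal_peak s * (s ^+ 2 *+ 2))).
apply: cvgM; first exact: cvg_cst.
by rewrite -cvg_shiftS; exact: cvg_harmonic.
Qed.

Lemma is_derive_normal_pdf (x : R) : is_derive x 1 pdf (- (x / s ^+ 2) * pdf x).
Proof.
rewrite normal_pdfE// /normal_fun; apply: is_derive_eq.
rewrite /GRing.scale/=.
by field.
Qed.

(** Since [- s^2 * pdf x] is an antiderivative of [x * pdf x], integration by parts on [[0, n]]
    turns the second moment into [s^2] times the mass, up to a boundary term that vanishes in the
    limit. *)
Lemma integral_sqr_normal_pdf :
  (\int[leb]_x ((x ^+ 2)%:E * (pdf x)%:E) = (s ^+ 2)%:E)%E.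
Proof.
have cpdf : continuous pdf by exact: continuous_normal_pdf.
have mpdf : measurable_fun [set: R] pdf by exact: measurable_normal_pdf.
have p0 x : 0 <= pdf x by exact: normal_pdf_ge0.
have cx2pdf : continuous (fun x : R => x ^+ 2 * pdf x).
  by move=> x; apply: cvgM; [exact: exprn_continuous|exact: cpdf].
have mx2pdf : measurable_fun [set: R] (fun x : R => x ^+ 2 * pdf x).
  exact: continuous_measurable_fun.
have x2p0 x : 0 <= x ^+ 2 * pdf x by rewrite mulr_ge0// sqr_ge0.
have posE : [set x : R | 0 <= x] = `[0, +oo[%classic.
  by apply/seteqP; split => x/=; rewrite in_itv/= andbT.
(* Evenness reduces both the mass and the second moment to the half-line. *)
have half : (2%:E * \int[leb]_(x in `[0%R, +oo[) (pdf x)%:E = 1)%E.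
  rewrite -posE -ge0_symfun_integralT//; first exact: integral_normal_pdf.
  by move=> x/=; rewrite normal_pdf_even.
under eq_integral do rewrite -EFinM.
rewrite ge0_symfun_integralT//; last first.
  by move=> x/=; rewrite normal_pdf_even sqrrN.
rewrite posE.
set I := (\int[leb]_(x in _) _)%E in half *.
suff -> : (\int[leb]_(x in `[0%R, +oo[) (x ^+ 2 * pdf x)%:E = (s ^+ 2)%:E * I)%E.
  by rewrite muleCA half mule1.
pose G (x : R) := - (s ^+ 2 * pdf x).
have dG (x : R) : is_derive x 1 G (x * pdf x).
  have := is_derive_normal_pdf x => dpdf.
  by apply: is_derive_eq; rewrite /GRing.scale/=; field.
have cG : continuous G.
  by move=> x; apply: cvgN; apply: cvgM; [exact: cvg_cst|exact: cpdf].
have parts n : (0 < n)%N ->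
    (\int[leb]_(x in `[0%R, n%:R]) (x ^+ 2 * pdf x)%:E =
     (s ^+ 2)%:E * \int[leb]_(x in `[0%R, n%:R]) (pdf x)%:E
     - (s ^+ 2 * (n%:R * pdf n%:R))%:E)%E.
  move=> n0; have n0' : 0 < n%:R :> R by rewrite ltr0n.
  have := @integration_by_parts R id G (cst 1) (fun x : R => x * pdf x) 0 n%:R n0'.
  have dLR (f : R -> R) : continuous f -> (forall x, derivable f x 1) ->
      derivable_oo_LRcontinuous f 0 n%:R.
    move=> cf df; split; first by move=> *; exact: df.
      by apply: cvg_at_right_filter; exact: cf.
    by apply: cvg_at_left_filter; exact: cf.
  under [in X in _ -> X]eq_integral do rewrite expr2 -mulrA.
  move=> -> //; last 6 first.
  - by apply: continuous_subspaceT => x; exact: cvg_cst.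
  - by apply: dLR => // x; exact: cvg_id.
  - by move=> x _; rewrite derive1E derive_id.
  - apply: continuous_subspaceT => x.
    by apply: cvgM; [exact: cvg_id|exact: cpdf].
  - by apply: dLR => // x; case: (dG x).
  - by move=> x _; rewrite derive1E; case: (dG x).
  have -> : (\int[leb]_(x in `[0%R, n%:R]) (cst 1 x * G x)%:E =
      - ((s ^+ 2)%:E * \int[leb]_(x in `[0%R, n%:R]) (pdf x)%:E))%E.
    rewrite -ge0_integralZl//; last 3 first.
    - by apply/measurable_EFinP/measurable_funTS.
    - by move=> x _; rewrite lee_fin.
    - by rewrite lee_fin sqr_ge0.
    rewrite -integral_ge0N => [|x _]; last by rewrite lee_fin mulr_ge0// sqr_ge0.
    by apply: eq_integral => x _; rewrite /cst/= mul1r.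
  rewrite oppeK addeC mul0r subr0; congr (_ + _)%E.
  by rewrite -EFinN /G; congr (_%:E); ring.
have /cvg_lim <- // := @ge0_cvgn_integral R leb _ x2p0 mx2pdf.
apply/cvg_lim => //; apply: cvg_trans.
  apply: near_eq_cvg; near=> n; apply/esym/parts; near: n.
  exact: nbhs_infty_gt.
rewrite -[((s ^+ 2)%:E * I)%E]sube0; apply: cvgeB => //.
- by rewrite fin_num_adde_defl.
- by apply: cvgeZl => //; exact: ge0_cvgn_integral.
- apply: cvg_EFin; first exact: nearW.
  have : s ^+ 2 * (n%:R * pdf n%:R) @[n --> \oo] --> s ^+ 2 * 0.
    by apply: cvgM; [exact: cvg_cst|exact: cvg_normal_pdf_id].
  by rewrite mulr0.
Unshelve. all: end_near.
Qed.

Lemma normal_prob_second_moment :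
  (\int[normal_prob 0 s]_x (x ^+ 2)%:E = (s ^+ 2)%:E)%E.
Proof.
rewrite -integral_sqr_normal_pdf; apply: (@ge0_integral_density _ _ R leb _ pdf).
- exact: measurable_normal_pdf.
- by move=> x; exact: normal_pdf_ge0.
- by [].
- by apply/measurable_EFinP; exact: measurable_funX.
- by move=> x; rewrite lee_fin sqr_ge0.
Qed.

End gaussian_second_moment.

(** * Iterated integrals over the cube *)

Section cube_measure.
Context {R : realType}.

(** Kernel and covariance identities are available on the cube only; this allows rewriting with them
    under [cube_int]. *)
Lemma eq_cube_int d (f g : d.-tuple R -> \bar R) :
  (forall x, cube x -> f x = g x) -> cube_int f = cube_int g.
Proof.
elim: d => [|d ih] in f g * => fg /=; first by apply: fg => -[].
apply: eq_integral => x; rewrite inE/= in_itv/= => x01.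
apply: ih => t ct; apply: fg => i; have [->|i0] := eqVneq i ord0.
  by rewrite tnth0.
have [j ->] : exists j, i = lift ord0 j.
  by case: (unliftP ord0 i) i0 => [j ->|-> /eqP//] _; exists j.
by rewrite tnthS.
Qed.

Local Notation U := (uniform_prob (@ltr01 R)).

(** Passing to a probability on the whole line gives the form in which the product measure theorems
    apply. Splitting into positive and negative parts covers [f] of any sign. *)
Lemma integral_uniform01 (f : measurableTypeR R -> \bar R) :
  measurable_fun setT f ->
  (\int[U]_x f x = \int[@lebesgue_measure R]_(x in `[0%R, 1%R]) f x)%E.
Proof.
move=> mf; rewrite [LHS]integralE [RHS]integralE.
rewrite !integral_uniform//; [|exact: measurable_funeneg|exact: measurable_funepos].
by rewrite subr0 invr1 !mul1e.
Qed.

(** The parameter space is arbitrary so that the induction on [d] can move the outer integration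
    variable into the parameter. Tonelli is applied to the positive and negative parts
    separately. *)
Lemma measurable_cube_int_param d dY (Y : measurableType dY)
    (h : Y * d.-tuple R -> \bar R) : measurable_fun setT h ->
  measurable_fun setT (fun y => cube_int (fun t => h (y, t))).
Proof.
elim: d => [|d ih] in dY Y h * => mh /=.
  by apply: measurableT_comp => //; exact: measurable_pair1.
pose k (z : Y * measurableTypeR R) :=
  cube_int (fun t : d.-tuple R => h (z.1, cons_tuple z.2 t)).
have mk : measurable_fun setT k.
  apply: (ih _ _ (fun u : (Y * measurableTypeR R) * d.-tuple R =>
     h (u.1.1, cons_tuple u.1.2 u.2))).
  apply: measurableT_comp => //; apply: measurable_fun_pair.
    exact: (measurableT_comp measurable_fst measurable_fst).
  apply: (@measurable_cons _ _ _ R (fun u : (Y * R) * d.-tuple R => u.1.2)) => //.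
  exact: (measurableT_comp measurable_snd measurable_fst).
rewrite (_ : (fun y => _) = (fun y => \int[U]_x k (y, x))%E); last first.
  apply/funext => y; rewrite integral_uniform01//.
  by apply: measurableT_comp => //; exact: measurable_pair1.
rewrite (_ : (fun y => _) = ((fun y => \int[U]_x k^\+ (y, x)) \-
    (fun y => \int[U]_x k^\- (y, x)))%E); last first.
  apply/funext => y; rewrite [LHS]integralE.
  under eq_integral do rewrite funepos_comp/=.
  by under [X in (_ - X = _)%E]eq_integral do rewrite funeneg_comp/=.
apply: emeasurable_funB.
  apply: (@measurable_fun_fubini_tonelli_F _ _ _ _ _ U k^\+%E) => //.
  exact: measurable_funepos.
apply: (@measurable_fun_fubini_tonelli_F _ _ _ _ _ U k^\-%E) => //.
exact: measurable_funeneg.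
Qed.

Lemma measurable_cons_pair d : measurable_fun setT
  (fun z : measurableTypeR R * d.-tuple R => cons_tuple z.1 z.2 : d.+1.-tuple R).
Proof.
apply: (@measurable_cons _ _ _ R (fun u : measurableTypeR R * d.-tuple R => u.1)).
  exact: measurable_fst.
exact: measurable_snd.
Qed.

Lemma measurable_cube_int_cons d (f : d.+1.-tuple R -> \bar R) :
  measurable_fun setT f ->
  measurable_fun [set: measurableTypeR R]
    (fun x => cube_int (fun t : d.-tuple R => f (cons_tuple x t))).
Proof.
move=> mf.
apply: (@measurable_cube_int_param _ _ (measurableTypeR R)
  (fun z => f (cons_tuple z.1 z.2))).
by apply: measurableT_comp => //; exact: measurable_cons_pair.
Qed.

(** By induction, the measure in dimension [d + 1] is the image of the product of [U] and [nu] under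
    [cons_tuple], starting from a point mass at the empty tuple. Tonelli gives the first property
    and Fubini the second. *)
Lemma cube_measure_exists d : exists nu : probability (d.-tuple R) R,
  (forall f : d.-tuple R -> \bar R, measurable_fun setT f ->
    (forall x, 0 <= f x)%E -> cube_int f = \int[nu]_x f x)%E /\
  (forall f : d.-tuple R -> \bar R, nu.-integrable setT f ->
    cube_int f = \int[nu]_x f x)%E.
Proof.
elim: d => [|d [nu [ge0_nu int_nu]]].
  exists (dirac [tuple]); split => [f mf _|f /measurable_int mf].
    by rewrite integral_dirac//= diracT mul1e.
  by rewrite integral_dirac//= diracT mul1e.
pose cns (z : measurableTypeR R * d.-tuple R) : d.+1.-tuple R :=
  cons_tuple z.1 z.2.
have mc : measurable_fun setT cns by exact: measurable_cons_pair.
pose c : {mfun (measurableTypeR R * d.-tuple R)%type >-> (d.+1.-tuple R)} :=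
  HB.pack cns (isMeasurableFun.Build _ _ _ _ cns mc).
exists (distribution (U \x nu)%E c); split => f.
  move=> mf f0 /=.
  have mfc : measurable_fun setT (f \o cns) by exact: measurableT_comp.
  rewrite ge0_integral_distribution// fubini_tonelli1//=.
  rewrite -integral_uniform01; last exact: measurable_cube_int_cons.
  apply: eq_integral => x _; apply: ge0_nu => //.
  rewrite -[X in measurable_fun _ X]/((f \o cns) \o pair x).
  by apply: measurableT_comp => //; exact: measurable_pair1.
move=> fint.
have mf : measurable_fun setT f by exact: measurable_int fint.
have mfc : measurable_fun setT (f \o cns) by exact: measurableT_comp.
have fcint : (U \x nu)%E.-integrable setT (f \o cns).
  apply/integrableP; split => //.
  move/integrableP : fint => [_].
  by rewrite ge0_integral_distribution//; exact: measurableT_comp.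
rewrite integral_distribution// -integral12_prod_meas1//=.
rewrite -integral_uniform01; last exact: measurable_cube_int_cons.
(* The sections of [f] are integrable for almost every first coordinate only, so the inner integrals
   are compared almost everywhere. *)
apply: ae_eq_integral => //.
- exact: measurable_cube_int_cons.
- exact: (measurable_fubini_F fcint).
have := ae_integrable1 fcint; apply: filterS => x intx _.
by rewrite int_nu.
Qed.

(* [cube_int] is an iterated integral, for which linearity and Fubini would have
   to be proved by induction on [d]; integrals against [cube_measure] have both. *)
Definition cube_measure d : probability (d.-tuple R) R :=
  sval (cid (cube_measure_exists d)).

Lemma ge0_cube_intE d (f : d.-tuple R -> \bar R) :
  measurable_fun setT f -> (forall x, 0 <= f x)%E ->
  (cube_int f = \int[cube_measure d]_x f x)%E.
Proof. by rewrite /cube_measure; case: cid => nu /= -[h _]; exact: h. Qed.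

Lemma cube_intE d (f : d.-tuple R -> \bar R) :
  (cube_measure d).-integrable setT f ->
  (cube_int f = \int[cube_measure d]_x f x)%E.
Proof. by rewrite /cube_measure; case: cid => nu /= -[_ h]; exact: h. Qed.

Lemma measurable_cube d : measurable (@cube R d).
Proof.
rewrite (_ : @cube R d = \bigcap_(i in [set: 'I_d])
    ((fun t : d.-tuple R => tnth t i) @^-1` `[0, 1]%classic)); last first.
  apply/seteqP; split => [t ct i _|t ct i]; first by rewrite /= in_itv/= ct.
  by have := ct i I; rewrite /= in_itv/=.
apply: fin_bigcap_measurable => // i _.
by rewrite -[X in measurable X]setTI; exact: measurable_tnth.
Qed.

End cube_measure.

(** * Square integrable functions *)

Section square_integrable.
Context d (T : measurableType d) (R : realType) (mu : {measure set T -> \bar R}).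
Implicit Types f g : T -> R.

Definition sqint f : Prop :=
  measurable_fun setT f /\ (\int[mu]_x (f x ^+ 2)%:E < +oo)%E.

Lemma sqint_integrable_sqr f : sqint f ->
  mu.-integrable setT (fun x => (f x ^+ 2)%:E).
Proof.
move=> [mf f2]; apply/integrableP; split.
  by apply/measurable_EFinP; exact: measurable_funX.
by under eq_integral do rewrite gee0_abs ?lee_fin ?sqr_ge0//.
Qed.

Lemma sqint_integrableM f g : sqint f -> sqint g ->
  mu.-integrable setT (fun x => (f x * g x)%:E).
Proof.
move=> f2 g2.
apply: (@le_integrable _ _ _ mu setT measurableT _
    (fun x => (f x ^+ 2)%:E + (g x ^+ 2)%:E)%E).
- by apply/measurable_EFinP; apply: measurable_funM; [case: f2|case: g2].
- move=> x _; rewrite -EFinD !abse_EFin lee_fin.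
  rewrite [leRHS]ger0_norm ?addr_ge0 ?sqr_ge0// ler_norml.
  by apply/andP; split; nra.
- by apply: integrableD => //; exact: sqint_integrable_sqr.
Qed.

Lemma sqintZ k f : sqint f -> sqint (fun x => k * f x).
Proof.
move=> f2; split; first by apply: measurable_funM => //; case: f2.
under eq_integral do rewrite exprMn EFinM.
rewrite integralZl//; last exact: sqint_integrable_sqr.
rewrite lte_mul_pinfty// ?lee_fin ?sqr_ge0//; by case: f2.
Qed.

Lemma sqintD f g : sqint f -> sqint g -> sqint (fun x => f x + g x).
Proof.
move=> f2 g2; have mD : measurable_fun setT (fun x => f x + g x).
  by apply: measurable_funD; [case: f2|case: g2].
split => //; apply: (@le_lt_trans _ _
    (\int[mu]_x (2%:E * ((f x ^+ 2)%:E + (g x ^+ 2)%:E)))%E).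
  apply: ge0_le_integral => //.
  - by move=> x _; rewrite lee_fin sqr_ge0.
  - by apply/measurable_EFinP; exact: measurable_funX.
  - apply: emeasurable_funM => //; apply: emeasurable_funD;
      apply/measurable_EFinP; apply: measurable_funX; [by case: f2|by case: g2].
  - by move=> x _; rewrite -EFinD -EFinM lee_fin; have := sqr_ge0 (f x - g x); nra.
rewrite ge0_integralZl//; last 2 first.
- by apply: emeasurable_funD; apply/measurable_EFinP; apply: measurable_funX;
    [case: f2|case: g2].
- by move=> x _; rewrite -EFinD lee_fin addr_ge0// sqr_ge0.
rewrite lte_mul_pinfty// ge0_integralD//; last 4 first.
- by move=> x _; rewrite lee_fin sqr_ge0.
- by apply/measurable_EFinP; apply: measurable_funX; case: f2.
- by move=> x _; rewrite lee_fin sqr_ge0.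
- by apply/measurable_EFinP; apply: measurable_funX; case: g2.
by apply: lte_add_pinfty; [case: f2|case: g2].
Qed.

Lemma sqintB f g : sqint f -> sqint g -> sqint (fun x => f x - g x).
Proof.
move=> f2 g2; have := sqintD f2 (sqintZ (-1) g2).
by congr sqint; apply/funext => x; rewrite mulN1r.
Qed.

Lemma sqint0 : sqint (fun=> 0).
Proof.
split => //; under eq_integral do rewrite expr0n.
by rewrite integral0.
Qed.

Lemma sqint_sum (I : eqType) (r : seq I) (F : I -> T -> R) :
  (forall i, i \in r -> sqint (F i)) -> sqint (fun x => \sum_(i <- r) F i x).
Proof.
elim: r => [|i r ih] F2.
  by under eq_fun do rewrite big_nil; exact: sqint0.
under eq_fun do rewrite big_cons; apply: sqintD.
  by apply: F2; rewrite mem_head.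
by apply: ih => j jr; apply: F2; rewrite in_cons jr orbT.
Qed.

(** A real number obtained through [fine], hence the [sqint] hypotheses wherever it has to represent
    the actual integral. *)
Definition ip f g : R := \int[mu]_x (f x * g x).

Lemma EFin_ip f g : sqint f -> sqint g ->
  ((ip f g)%:E = \int[mu]_x (f x * g x)%:E)%E.
Proof.
by move=> f2 g2; rewrite fineK// integrable_fin_num// sqint_integrableM.
Qed.

Lemma EFin_ip_sqr f : sqint f -> ((ip f f)%:E = \int[mu]_x (f x ^+ 2)%:E)%E.
Proof. by move=> f2; rewrite EFin_ip//; under eq_integral do rewrite -expr2. Qed.

Lemma ipC f g : ip f g = ip g f.
Proof. by apply: eq_Rintegral => x _; rewrite mulrC. Qed.

Lemma ipDl f g h : sqint f -> sqint g -> sqint h ->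
  ip (fun x => f x + g x) h = ip f h + ip g h.
Proof.
move=> f2 g2 h2; rewrite /ip; under eq_Rintegral do rewrite mulrDl.
by rewrite RintegralD//; exact: sqint_integrableM.
Qed.

Lemma ipZl k f h : sqint f -> sqint h -> ip (fun x => k * f x) h = k * ip f h.
Proof.
move=> f2 h2; rewrite /ip; under eq_Rintegral do rewrite -mulrA.
by rewrite RintegralZl//; exact: sqint_integrableM.
Qed.

Lemma ipBl f g h : sqint f -> sqint g -> sqint h ->
  ip (fun x => f x - g x) h = ip f h - ip g h.
Proof.
move=> f2 g2 h2; rewrite /ip; under eq_Rintegral do rewrite mulrBl.
by rewrite RintegralB//; exact: sqint_integrableM.
Qed.

Lemma ip_suml (I : eqType) (r : seq I) (F : I -> T -> R) h :
  (forall i, i \in r -> sqint (F i)) -> sqint h ->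
  ip (fun x => \sum_(i <- r) F i x) h = \sum_(i <- r) ip (F i) h.
Proof.
elim: r => [|i r ih] F2 h2.
  rewrite big_nil /ip; under eq_Rintegral do rewrite big_nil mul0r.
  by rewrite Rintegral_cst// mul0r.
have r2 j : j \in r -> sqint (F j) by move=> jr; apply: F2; rewrite in_cons jr orbT.
rewrite big_cons -ih// -ipDl//; last 2 first.
- by apply: F2; rewrite mem_head.
- exact: sqint_sum.
by congr ip; apply/funext => x; rewrite big_cons.
Qed.

Lemma ip_ge0 f : 0 <= ip f f.
Proof. by apply: Rintegral_ge0 => x _; rewrite -expr2 sqr_ge0. Qed.

(** The squared norm of [f - t g] is a nonnegative quadratic in [t], evaluated at its minimizer. *)
Lemma ip_cauchy_schwarz f g : sqint f -> sqint g ->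
  ip f g ^+ 2 <= ip f f * ip g g.
Proof.
move=> f2 g2.
have key t : 0 <= ip f f - 2 * t * ip f g + t ^+ 2 * ip g g.
  have tg := sqintZ t g2; have := ip_ge0 (fun x => f x - t * g x).
  have d2 : sqint (fun x => f x - t * g x) by exact: sqintB.
  rewrite ipBl// ipZl// (ipC f) (ipC g) !ipBl// !ipZl// (ipC g f).
  by rewrite (_ : _ - _ = ip f f - 2 * t * ip f g + t ^+ 2 * ip g g)//; ring.
have [g0|g0] := eqVneq (ip g g) 0.
  have [->|h0] := eqVneq (ip f g) 0; first by rewrite expr0n g0 mulr0.
  (* With [ip g g = 0] the quadratic is affine in [t], and this [t] would give it the value [-1]. *)
  have := key ((ip f f + 1) / (2 * ip f g)); rewrite g0 !mulr0 addr0.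
  have -> : 2 * ((ip f f + 1) / (2 * ip f g)) * ip f g = ip f f + 1 by field.
  by rewrite opprD addrA subrr sub0r oppr_ge0 ler10.
have gp : 0 < ip g g by rewrite lt_neqAle eq_sym g0 ip_ge0.
have := key (ip f g / ip g g).
have -> : ip f f - 2 * (ip f g / ip g g) * ip f g + (ip f g / ip g g) ^+ 2 * ip g g
  = ip f f - ip f g ^+ 2 / ip g g by field.
by rewrite subr_ge0 ler_pdivrMr.
Qed.

End square_integrable.

Lemma sqint_cst d (T : measurableType d) (R : realType) (P : probability T R) (c : R) :
  sqint P (fun=> c).
Proof.
split => //; have -> : (\int[P]_x (c ^+ 2)%:E = (c ^+ 2)%:E * P setT)%E.
  exact: integral_cst.
have -> : P setT = 1%E by exact: probability_setT.
by rewrite mule1 ltry.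
Qed.

(** * Covariance of the Gaussian field *)

Section gaussian_covariance.
Context {R : realType} (d : nat).
Local Notation X := (d.-tuple R).
Variables (K : X -> X -> R) (eta : nat -> X -> R).
Hypothesis K_basis : kernel_of_basis K eta.

Lemma kernelC x y : cube x -> cube y -> K x y = K y x.
Proof.
move=> cx cy; rewrite -(cvg_lim _ (K_basis cx cy))// -(cvg_lim _ (K_basis cy cx))//.
congr (limn _); apply/funext => n; apply: eq_bigr => j _; exact: mulrC.
Qed.

Lemma cvg_kernel_diag x : cube x -> \sum_(j < n) eta j x ^+ 2 @[n --> \oo] --> K x x.
Proof.
move=> cx; apply: cvg_trans (K_basis cx cx); apply: near_eq_cvg; apply: nearW => n.
by apply: eq_bigr => j _; rewrite expr2.
Qed.

Lemma kernel_diag_ge n x : cube x -> \sum_(j < n) eta j x ^+ 2 <= K x x.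
Proof.
move=> cx; have h := cvg_kernel_diag cx.
rewrite -(cvg_lim _ h)//; apply: nondecreasing_cvgn_le; last by apply/cvg_ex; eexists; exact: h.
apply/nondecreasing_seqP => m; rewrite big_ord_recr/= lerDl sqr_ge0//.
Qed.

(** The form is the limit of the sums of [(a * eta j x + b * eta j y)^2]. It is the variance [v] of
    [centered_gaussian_field], so the degenerate case there is exactly [v = 0]. *)
Lemma kernel_pair_ge0 x y (a b : R) : cube x -> cube y ->
  0 <= a ^+ 2 * K x x + 2 * a * b * K x y + b ^+ 2 * K y y.
Proof.
move=> cx cy.
have h : a ^+ 2 * (\sum_(j < n) eta j x ^+ 2)
      + 2 * a * b * (\sum_(j < n) eta j x * eta j y)
      + b ^+ 2 * (\sum_(j < n) eta j y ^+ 2) @[n --> \oo]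
    --> a ^+ 2 * K x x + 2 * a * b * K x y + b ^+ 2 * K y y.
  apply: cvgD; first apply: cvgD; apply: cvgM; try exact: cvg_cst.
  - exact: cvg_kernel_diag.
  - exact: K_basis.
  - exact: cvg_kernel_diag.
rewrite -(cvg_lim _ h)//; apply: limr_ge; first by apply/cvg_ex; eexists; exact: h.
apply: nearW => n; rewrite !mulr_sumr -!big_split/=; apply: sumr_ge0 => j _.
by have := sqr_ge0 (a * eta j x + b * eta j y); nra.
Qed.

Variables (dO : measure_display) (Omega : measurableType dO).
Variables (mu : probability Omega R) (F : Omega -> X -> R).
Hypothesis F_gauss : centered_gaussian_field mu F K.

(** The law of the combination is normal with variance [v], or the point mass at 0 if [v = 0]; in
    both cases the second moment is [v]. *)
Lemma gaussian_field_pair x y (a b : R) : cube x -> cube y ->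
  measurable_fun setT (fun w => a * F w x + b * F w y) /\
  (\int[mu]_w ((a * F w x + b * F w y) ^+ 2)%:E =
   (a ^+ 2 * K x x + 2 * a * b * K x y + b ^+ 2 * K y y)%:E)%E.
Proof.
move=> cx cy; have cs p : p \in [:: (a, x); (b, y)] -> cube p.2.
  by rewrite !inE => /orP[|] /eqP ->.
have := F_gauss cs; set v := (\sum_(p <- _) \sum_(q <- _) _).
have -> : (fun w => \sum_(p <- [:: (a, x); (b, y)]) p.1 * F w p.2) =
    (fun w => a * F w x + b * F w y).
  by apply/funext => w; rewrite !big_cons big_nil addr0.
have vE : v = a ^+ 2 * K x x + 2 * a * b * K x y + b ^+ 2 * K y y.
  by rewrite /v !big_cons !big_nil !addr0/= (kernelC cy cx); ring.
set Y := (fun w => _); move=> [mY lawY]; split => //; rewrite -vE.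
have v0 : 0 <= v by rewrite vE kernel_pair_ge0.
have mY' : measurable_fun [set: Omega] (Y : Omega -> measurableTypeR R) by exact: mY.
pose Z : {mfun Omega >-> measurableTypeR R} :=
  HB.pack (Y : Omega -> measurableTypeR R) (isMeasurableFun.Build _ _ _ _ _ mY').
have msq : measurable_fun [set: measurableTypeR R] (fun z : R => (z ^+ 2)%:E).
  by apply/measurable_EFinP; exact: measurable_funX.
have sq0 (z : measurableTypeR R) : (0 <= ((z : R) ^+ 2)%:E)%E by rewrite lee_fin sqr_ge0.
rewrite -[LHS](@ge0_integral_distribution _ _ _ _ R mu Z (fun z : R => (z ^+ 2)%:E))//.
have [vp|vn] := ltP 0 v.
  have -> : v = Num.sqrt v ^+ 2 by rewrite sqr_sqrtr.
  rewrite -normal_prob_second_moment ?gt_eqF ?sqrtr_gt0//.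
  apply: eq_measure_integral => A mA _.
  by have := lawY A mA; rewrite vp.
have -> : v = 0 by apply/eqP; rewrite eq_le vn v0.
transitivity (\int[dirac (0%R : measurableTypeR R)]_z (((z : R) ^+ 2)%:E : \bar R))%E.
  apply: eq_measure_integral => A mA _.
  by have := lawY A mA; rewrite ltNge vn.
by rewrite integral_dirac// diracT mul1e expr0n.
Qed.

Lemma gaussian_field_sqint x : cube x -> sqint mu (F ^~ x).
Proof.
move=> cx; have [] := gaussian_field_pair 1 0 cx cx.
have -> : (fun w => 1 * F w x + 0 * F w x) = F ^~ x.
  by apply/funext => w; rewrite mul1r mul0r addr0.
move=> mF iF; split => //.
rewrite (eq_integral (fun w => ((1 * F w x + 0 * F w x) ^+ 2)%:E)) ?iF ?ltry//.
by move=> w _; rewrite mul1r mul0r addr0.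
Qed.

Lemma gaussian_field_sqr x : cube x -> (\int[mu]_w (F w x ^+ 2)%:E = (K x x)%:E)%E.
Proof.
move=> cx; have [_] := gaussian_field_pair 1 0 cx cx.
rewrite expr1n mul1r mulr0 mul0r expr0n mul0r !addr0 => <-.
by apply: eq_integral => w _; rewrite mul1r mul0r addr0.
Qed.

(** Polarization: the second moments of [F x], [F y] and [F x + F y] determine the mixed one. *)
Lemma gaussian_field_cov x y : cube x -> cube y ->
  ip mu (F ^~ x) (F ^~ y) = K x y.
Proof.
move=> cx cy; have Fx := gaussian_field_sqint cx; have Fy := gaussian_field_sqint cy.
have [_ h] := gaussian_field_pair 1 1 cx cy.
have E z : cube z -> ip mu (F ^~ z) (F ^~ z) = K z z.
  move=> cz; apply: EFin_inj; rewrite EFin_ip_sqr ?gaussian_field_sqr//.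
  exact: gaussian_field_sqint.
have : ip mu (fun w => F w x + F w y) (fun w => F w x + F w y) =
    K x x + 2 * K x y + K y y.
  apply: EFin_inj; rewrite EFin_ip_sqr; last exact: sqintD.
  rewrite (eq_integral (fun w => ((1 * F w x + 1 * F w y) ^+ 2)%:E)).
    by rewrite h !expr1n !mul1r !mulr1.
  by move=> w _; rewrite !mul1r.
have Fxy := sqintD Fx Fy.
rewrite ipDl// ![ip mu _ (fun w => _ + _)]ipC !ipDl// (ipC _ (F ^~ y)) !E//.
lra.
Qed.

End gaussian_covariance.

(** * Integrals of a random field *)

Section random_field.
Context d1 d2 (T1 : measurableType d1) (T2 : measurableType d2) (R : realType).
Variables (mu : probability T1 R) (nu : probability T2 R) (F : T1 -> T2 -> R).
Hypothesis mF : measurable_fun setT (fun z : T1 * T2 => F z.1 z.2).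
Hypothesis F_row : forall w, sqint nu (F w).
Hypothesis F_sq : (\int[mu]_w \int[nu]_x (F w x ^+ 2)%:E < +oo)%E.

(** The integrand is dominated by [F^2 + (V h)^2]. Every later exchange of expectation and spatial
    integral of a product with [F] rests on this. *)
Lemma integrable_field_mul (h : T2 -> R) (V : T1 -> R) : sqint nu h -> sqint mu V ->
  (mu \x nu)%E.-integrable setT (fun z => (F z.1 z.2 * h z.2 * V z.1)%:E).
Proof.
move=> h2 V2; have [mh _] := h2; have [mV _] := V2.
have mh' : measurable_fun setT (fun z : T1 * T2 => h z.2).
  exact: (measurableT_comp mh measurable_snd).
have mV' : measurable_fun setT (fun z : T1 * T2 => V z.1).
  exact: (measurableT_comp mV measurable_fst).
have iF : (mu \x nu)%E.-integrable setT (fun z => (F z.1 z.2 ^+ 2)%:E).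
  apply/integrable12ltyP; first by apply/measurable_EFinP; exact: measurable_funX.
  apply: le_lt_trans F_sq; rewrite le_eqVlt; apply/orP; left; apply/eqP.
  apply: eq_integral => w _; apply: eq_integral => x _.
  by rewrite gee0_abs// lee_fin sqr_ge0.
have ihV : (mu \x nu)%E.-integrable setT (fun z => ((V z.1 * h z.2) ^+ 2)%:E).
  apply/integrable12ltyP.
    by apply/measurable_EFinP; apply: measurable_funX; exact: measurable_funM.
  rewrite (eq_integral (fun w => (V w ^+ 2)%:E * (ip nu h h)%:E)%E); last first.
    move=> w _; rewrite EFin_ip_sqr// -integralZl//; last exact: sqint_integrable_sqr.
    by apply: eq_integral => x _; rewrite gee0_abs ?lee_fin ?sqr_ge0// exprMn EFinM.
  rewrite integralZr//; last exact: sqint_integrable_sqr.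
  rewrite -EFin_ip_sqr//; exact: ltry.
apply: (le_integrable _ _ _ (integrableD _ iF ihV)) => //.
  by apply/measurable_EFinP; apply: measurable_funM => //; exact: measurable_funM.
move=> [w x] _ /=; rewrite lee_fin.
rewrite [leRHS]ger0_norm ?addr_ge0 ?sqr_ge0// ler_norml.
by apply/andP; split; nra.
Qed.

Lemma field_ip_row (h : T2 -> R) (V : T1 -> R) w : sqint nu h ->
  (\int[nu]_x (F w x * h x * V w)%:E = (ip nu (F w) h * V w)%:E)%E.
Proof.
move=> h2; under eq_integral do rewrite EFinM.
rewrite integralZr//; last exact: sqint_integrableM.
by rewrite -EFin_ip.
Qed.

(** Cauchy-Schwarz in the space variable bounds the square by [ip nu h h] times the squared norm of
    [F w], which has finite expectation. *)
Lemma sqint_field_ip (h : T2 -> R) : sqint nu h -> sqint mu (fun w => ip nu (F w) h).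
Proof.
move=> h2; have V2 : sqint mu (cst 1).
  exact: sqint_cst.
have mip : measurable_fun setT (fun w => ip nu (F w) h).
  apply/measurable_EFinP.
  rewrite (_ : _ \o _ = fubini_F nu (fun z => (F z.1 z.2 * h z.2 * cst 1 z.1)%:E)).
    exact: (measurable_fubini_F (integrable_field_mul h2 V2)).
  by apply/funext => w; rewrite /fubini_F/= field_ip_row// mulr1.
split => //.
apply: (@le_lt_trans _ _
    (\int[mu]_w ((ip nu h h)%:E * \int[nu]_x (F w x ^+ 2)%:E))%E).
  have mi : measurable_fun setT (fun w => \int[nu]_x (F w x ^+ 2)%:E)%E.
    apply: (@measurable_fun_fubini_tonelli_F _ _ _ _ _ nu
      (fun z => (F z.1 z.2 ^+ 2)%:E)).
      by apply/measurable_EFinP; exact: measurable_funX.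
    by move=> z; rewrite lee_fin sqr_ge0.
  apply: ge0_le_integral => //.
  - by move=> w _; rewrite lee_fin sqr_ge0.
  - by apply/measurable_EFinP; exact: measurable_funX.
  - exact: emeasurable_funM.
  - move=> w _; rewrite -EFin_ip_sqr// -EFinM lee_fin mulrC.
    exact: ip_cauchy_schwarz.
rewrite ge0_integralZl//.
- by rewrite lte_mul_pinfty// lee_fin ip_ge0.
- apply: (@measurable_fun_fubini_tonelli_F _ _ _ _ _ nu
      (fun z => (F z.1 z.2 ^+ 2)%:E)).
    by apply/measurable_EFinP; exact: measurable_funX.
  by move=> z; rewrite lee_fin sqr_ge0.
- by move=> w _; apply: integral_ge0 => x _; rewrite lee_fin sqr_ge0.
- by rewrite lee_fin ip_ge0.
Qed.

Lemma integrable_field_col (h : T2 -> R) (V : T1 -> R) : sqint nu h -> sqint mu V ->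
  nu.-integrable setT (fun x => \int[mu]_w (F w x * h x * V w)%:E)%E.
Proof.
move=> h2 V2; have iF := integrable_field_mul h2 V2.
have mF' := measurable_int _ iF.
apply/integrableP; split; first exact: (measurable_fubini_G iF).
have := (integrable21ltyP _ _ mF').1 iF; apply: le_lt_trans.
apply: ge0_le_integral => //.
- by apply: measurableT_comp => //; exact: (measurable_fubini_G iF).
- apply: (@measurable_fun_fubini_tonelli_G _ _ _ _ _ mu
    (fun z => `|(F z.1 z.2 * h z.2 * V z.1)%:E|%E)) => //.
  by apply: measurableT_comp.
- move=> x _; apply: le_abse_integral => //.
  rewrite -[X in measurable_fun _ X]/((fun z : T1 * T2 =>
    (F z.1 z.2 * h z.2 * V z.1)%:E) \o (pair ^~ x)).
  by apply: measurableT_comp => //; exact: measurable_pair2.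
Qed.

(** By Fubini; on the right the inner integral at a fixed point is a covariance, which can be
    computed. *)
Lemma field_ip_col (h : T2 -> R) (V : T1 -> R) : sqint nu h -> sqint mu V ->
  ((ip mu (fun w => ip nu (F w) h) V)%:E =
   \int[nu]_x \int[mu]_w (F w x * h x * V w)%:E)%E.
Proof.
move=> h2 V2; rewrite -(Fubini (integrable_field_mul h2 V2))/= EFin_ip//.
  by apply: eq_integral => w _; rewrite field_ip_row.
exact: sqint_field_ip.
Qed.

End random_field.

(** * Functionals of finitely many function values *)

Section node_functionals.
Context {R : realType} (d : nat).
Local Notation X := (d.-tuple R).
Implicit Types (T : seq X) (Phi Psi : (X -> R) -> R) (f g : X -> R).

(** No weights appear, which makes the closure properties immediate; [node_functional_repr] recovers
    them. *)
Definition node_functional T Phi : Prop :=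
  (forall a f g, Phi (fun x => a * f x + g x) = a * Phi f + Phi g) /\
  (forall f g, (forall t, t \in T -> f t = g t) -> Phi f = Phi g).

Lemma node_functional_eval T t : t \in T -> node_functional T (fun f => f t).
Proof. by move=> tT; split => // f g; apply. Qed.

Lemma node_functional0 T : node_functional T (fun=> 0).
Proof. by split => // *; rewrite mulr0 addr0. Qed.

Lemma node_functionalD T Phi Psi : node_functional T Phi -> node_functional T Psi ->
  node_functional T (fun f => Phi f + Psi f).
Proof.
move=> [l1 e1] [l2 e2]; split => [a f g|f g fg].
  by rewrite l1 l2; ring.
by rewrite (e1 f g)// (e2 f g).
Qed.

Lemma node_functionalZ T c Phi : node_functional T Phi ->
  node_functional T (fun f => c * Phi f).
Proof.
move=> [l1 e1]; split => [a f g|f g fg].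
  by rewrite l1; ring.
by rewrite (e1 f g).
Qed.

Lemma node_functionalB T Phi Psi : node_functional T Phi -> node_functional T Psi ->
  node_functional T (fun f => Phi f - Psi f).
Proof.
move=> [l1 e1] [l2 e2]; split => [a f g|f g fg].
  by rewrite l1 l2; ring.
by rewrite (e1 f g)// (e2 f g).
Qed.

Lemma node_functional_sum (I : eqType) (r : seq I) T (Phi : I -> (X -> R) -> R) :
  (forall i, i \in r -> node_functional T (Phi i)) ->
  node_functional T (fun f => \sum_(i <- r) Phi i f).
Proof.
elim: r => [|i r ih] h.
  by under eq_fun do rewrite big_nil; exact: node_functional0.
under eq_fun do rewrite big_cons; apply: node_functionalD.
  by apply: h; rewrite mem_head.
by apply: ih => j jr; apply: h; rewrite in_cons jr orbT.
Qed.

Lemma node_functional_sub T T' Phi : {subset T <= T'} ->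
  node_functional T Phi -> node_functional T' Phi.
Proof. by move=> sT [l e]; split => // f g fg; apply: e => t /sT; exact: fg. Qed.

(** On [T], [f] agrees with a combination of point indicators, and [Phi] is linear. Without [undup]
    a repeated node would be counted several times. *)
Lemma node_functional_repr T Phi : node_functional T Phi ->
  forall f, Phi f = \sum_(t <- undup T) Phi (fun x => (x == t)%:R) * f t.
Proof.
move=> [l e] f.
have Phi0 : Phi (fun=> 0) = 0.
  have := l 1 (fun=> 0) (fun=> 0); rewrite mulr0 addr0 mul1r => /eqP.
  by rewrite -subr_eq0 opprD addrA subrr sub0r oppr_eq0 => /eqP.
have sumE s : Phi (fun x => \sum_(t <- s) f t * (x == t)%:R) =
    \sum_(t <- s) Phi (fun x => (x == t)%:R) * f t.
  elim: s => [|t s ih].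
    by rewrite big_nil -[RHS]Phi0; congr Phi; apply/funext => x; rewrite big_nil.
  rewrite big_cons -ih mulrC -l; congr Phi; apply/funext => x.
  by rewrite big_cons.
rewrite -sumE; apply: e => t tT.
rewrite (bigD1_seq t) ?mem_undup ?undup_uniq//= eqxx mulr1 big1 ?addr0// => u ut.
by rewrite eq_sym (negbTE ut) mulr0.
Qed.

End node_functionals.

(** * Algorithms and cubature rules as finite-rank maps of node values *)

Section algorithm_structure.
Context {R : realType} (d : nat).
Local Notation X := (d.-tuple R).
Local Notation nu := (@cube_measure R d).
Variables (lam : nat -> R) (eta : nat -> X -> R).

Lemma L2dotE (f g : X -> R) : sqint nu f -> sqint nu g -> L2dot f g = ip nu f g.
Proof.
by move=> f2 g2; rewrite /L2dot cube_intE//; exact: sqint_integrableM.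
Qed.

Lemma rintE (f : X -> R) : sqint nu f -> rint f = ip nu f (fun=> 1).
Proof.
move=> f2; rewrite -L2dotE//; last exact: sqint_cst.
by rewrite /rint /L2dot; congr (fine (cube_int _)); apply/funext => x; rewrite mulr1.
Qed.

Hypothesis eta_sqint : forall j, sqint nu (eta j).

Lemma sqint_xi j : sqint nu (xi lam eta j).
Proof.
rewrite (_ : xi lam eta j = fun x => (Num.sqrt (lam j))^-1 * eta j x).
  exact: sqintZ.
by apply/funext => x; rewrite /xi mulrC.
Qed.

Lemma sqint_span M (c : nat -> R) : sqint nu (fun x => \sum_(j < M) c j * eta j x).
Proof. by apply: sqint_sum => j _; exact: sqintZ. Qed.

Lemma ip_span M (c : nat -> R) (h : X -> R) : sqint nu h ->
  ip nu (fun x => \sum_(j < M) c j * eta j x) h = \sum_(j < M) c j * ip nu (eta j) h.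
Proof.
move=> h2; rewrite ip_suml//; last by move=> j _; exact: sqintZ.
by apply: eq_bigr => j _; rewrite ipZl.
Qed.

(** Besides the nodes, the rank is recorded: with output in the span of the first [M] basis
    functions, the coordinate of index [M] is missed. *)
Definition node_algorithm (T : seq X) (M : nat) (A : (X -> R) -> (X -> R)) : Prop :=
  exists Phi : nat -> (X -> R) -> R,
    (forall j, node_functional T (Phi j)) /\
    (forall f, A f = fun x => \sum_(j < M) Phi j f * eta j x).

Lemma node_functional_point T M A t : node_algorithm T M A ->
  node_functional T (fun f => A f t).
Proof.
move=> [Phi [nfPhi AE]]; under eq_fun do rewrite AE.
apply: node_functional_sum => j _; under eq_fun do rewrite mulrC.
exact: node_functionalZ.
Qed.

Lemma node_functional_ip T M A h : sqint nu h -> node_algorithm T M A ->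
  node_functional T (fun f => ip nu (A f) h).
Proof.
move=> h2 [Phi [nfPhi AE]].
rewrite (_ : (fun f => _) = fun f => \sum_(j < M) Phi j f * ip nu (eta j) h).
  2: by apply/funext => f; rewrite AE (ip_span M (fun j => Phi j f)).
apply: node_functional_sum => j _; under eq_fun do rewrite mulrC.
exact: node_functionalZ.
Qed.

Lemma node_functional_residual T M A t P : node_algorithm T M A -> t \in P ->
  node_functional (T ++ P) (fun f => f t - A f t).
Proof.
move=> nA tP; apply: node_functionalB.
  by apply: node_functional_eval; rewrite mem_cat tP orbT.
apply: node_functional_sub (node_functional_point t nA).
by move=> u uT; rewrite mem_cat uT.
Qed.

Lemma node_algorithm0 : node_algorithm [::] 0 (fun _ _ => 0).
Proof.
exists (fun _ _ => 0); split => [j|f]; first exact: node_functional0.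
by apply/funext => x; rewrite big_ord0.
Qed.

(** The rank becomes [m], whatever [M] was, because the step projects [A f] instead of adding to it.
    The factor [(Num.sqrt (lam j))^-1] converts [xi] into [eta]. *)
Lemma node_algorithm_stepA T M A P m : node_algorithm T M A ->
  node_algorithm (T ++ P) m (stepA lam eta P A m).
Proof.
move=> nA; exists (fun j f => (Num.sqrt (lam j))^-1 *
  (ip nu (A f) (xi lam eta j) + (size P)%:R^-1 * \sum_(t <- P)
     xi lam eta j t / u_m lam eta m t * (f t - A f t))); split => [j|f].
  apply/node_functionalZ/node_functionalD.
    apply: node_functional_sub (node_functional_ip (sqint_xi j) nA).
    by move=> u uT; rewrite mem_cat uT.
  apply/node_functionalZ/node_functional_sum => t tP.
  by apply: node_functionalZ; exact: (node_functional_residual nA tP).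
apply/funext => x; apply: eq_bigr => j _; rewrite -[in RHS]mulrA [in RHS]mulrCA.
congr (_ * _); last by rewrite /xi mulrC.
congr (_ + _ * _).
  rewrite L2dotE//; last exact: sqint_xi.
  by case: nA => Phi [_ ->]; exact: (sqint_span M (fun j => Phi j f)).
by apply: eq_bigr => t _; rewrite -mulrA mulrC.
Qed.

Lemma node_functional_cubQ T M A P : node_algorithm T M A ->
  node_functional (T ++ P) (cubQ P A).
Proof.
move=> nA; have [Phi [_ AE]] := nA.
rewrite (_ : cubQ P A = fun f => ip nu (A f) (fun=> 1) +
    (size P)%:R^-1 * \sum_(t <- P) (f t - A f t)); last first.
  by apply/funext => f; rewrite /cubQ rintE// AE; exact: (sqint_span M (fun j => Phi j f)).
apply: node_functionalD.
  apply: node_functional_sub (node_functional_ip (sqint_cst nu 1) nA).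
  by move=> u uT; rewrite mem_cat uT.
apply/node_functionalZ/node_functional_sum => t tP.
exact: (node_functional_residual nA tP).
Qed.

Variables (dO : measure_display) (Omega : measurableType dO).
Variables (mu : probability Omega R) (F : Omega -> X -> R) (C p : R).
Variables (P : nat -> seq X) (N : nat).
Hypothesis HP : forall k, (K_p p < k <= N)%N ->
  size (P k) = (2 ^ k.-1)%N /\ (forall t, t \in P k -> cube t).

(** Stage [k + 1] adds [2^k] nodes to at most [2^k] old ones. In this section [N] bounds the stages;
    it is later instantiated with [kappa N]. *)
Lemma node_algorithm_Alg k : (k <= N)%N -> exists T M,
  [/\ (size T <= 2 ^ k)%N, (forall t, t \in T -> cube t) &
      node_algorithm T M (Alg mu F lam eta C p P k)].
Proof.
elim: k => [|k ih] kN /=.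
  by exists [::], 0%N; split => //; exact: node_algorithm0.
case: ifPn => [_|]; first by exists [::], 0%N; split => //; exact: node_algorithm0.
rewrite -ltnNge => Kk.
have [sP cP] : size (P k.+1) = (2 ^ k)%N /\ (forall t, t \in P k.+1 -> cube t).
  by apply: HP; rewrite Kk.
have [T [M [sT cT nA]]] := ih (ltnW kN).
exists (T ++ P k.+1), (m_k C p (eapp2 mu F (Alg mu F lam eta C p P k)) k); split.
- by rewrite size_cat sP expnS mul2n -addnn leq_add2r.
- by move=> t; rewrite mem_cat => /orP[/cT|/cP].
- by apply: node_algorithm_stepA; exact: nA.
Qed.

End algorithm_structure.

(** * The recursion for the error bound *)

Section recursion_constants.
Context {R : realType}.
Variable p : R.
Hypothesis p_pos : 0 < p.
Local Notation a := (p + 1).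
Local Notation omega := (omega_p p (y_p p)).

Let a_pos : 0 < a. Proof. by rewrite addr_gt0. Qed.
Let a_neq0 : a != 0. Proof. by rewrite gt_eqF. Qed.

(** Identities between products of real powers are proved by taking logarithms, after which [field]
    or [ring] closes them. *)
Lemma ln_eq (x y : R) : 0 < x -> 0 < y -> ln x = ln y -> x = y.
Proof. by move=> x0 y0 /ln_inj; apply; rewrite posrE. Qed.

Lemma lnMp (x y : R) : 0 < x -> 0 < y -> ln (x * y) = ln x + ln y.
Proof. by move=> x0 y0; rewrite lnM ?posrE. Qed.

Lemma lnVp (x : R) : 0 < x -> ln x^-1 = - ln x.
Proof. by move=> x0; rewrite lnV ?posrE. Qed.

Ltac pos := repeat first [assumption | (by rewrite ltr0n) | apply: mulr_gt0 |
  apply: powR_gt0 | (rewrite invr_gt0) ].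
Ltac lnE := repeat first [rewrite ln_powR | rewrite lnMp; [|by pos|by pos] |
  rewrite lnVp; [|by pos]].

Lemma ler_powRN (x y : R) : 0 < x -> x <= y -> y `^ (- p) <= x `^ (- p).
Proof.
move=> x0 xy; have y0 := lt_le_trans x0 xy.
rewrite !powRN lef_pV2 ?posrE ?powR_gt0//.
by apply: ge0_ler_powR => //; rewrite ?nnegrE ltW.
Qed.

Lemma y_p_gt0 : 0 < y_p p. Proof. exact: powR_gt0. Qed.

Lemma omega_gt0 : 0 < omega.
Proof. by rewrite addr_gt0 ?y_p_gt0// powR_gt0// y_p_gt0. Qed.

(** As [y_p^(p+1) = p], one has [y_p = p * y_p^(-p)], so [omega = (1 + p) * y_p^(-p)]. *)
Lemma omega_powR : omega `^ a = (1 + p) * (1 + p^-1) `^ p.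
Proof.
have y0 := y_p_gt0; have p1 : 0 < 1 + p by rewrite addr_gt0.
have yE : y_p p = y_p p `^ (- p) * p.
  by apply: ln_eq; [pos|pos|]; lnE; field.
have -> : omega = y_p p `^ (- p) * (1 + p).
  by rewrite /omega_p {1}yE mulrDr mulr1 addrC.
have -> : 1 + p^-1 = (1 + p) / p by field; rewrite gt_eqF.
have q0 : 0 < (1 + p) / p by rewrite divr_gt0.
by apply: ln_eq; [pos|pos|]; lnE; rewrite /y_p; lnE; field.
Qed.

Lemma omega_ge1 : 1 <= omega.
Proof.
rewrite /omega_p; have [y1|y1] := leP 1 (y_p p).
  by rewrite ler_wpDr// powR_ge0.
apply: ler_wpDl; first exact: ltW y_p_gt0.
have := ler_powRN y_p_gt0 (ltW y1); by rewrite powR1.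
Qed.

(** The constant [B] of the invariant, determined by the fixed point equation
    [B = 2^p * omega * B^(p/(p+1))] of the recursion. *)
Definition rec_const : R := (2 `^ p * omega) `^ a.

(** [K_p] is the integer part of the binary logarithm of [Y], so [2^k <= Y], and [Y^p] equals
    [rec_const]. *)
Lemma rec_const_base k : (k <= K_p p)%N -> 1 <= rec_const * (2 ^+ k) `^ (- p).
Proof.
move=> kK; have t0 : 0 < 2 ^+ k :> R by rewrite exprn_gt0.
rewrite powRN ler_pdivlMr ?powR_gt0// mul1r.
set Y := 2 `^ a * omega `^ (1 + p^-1).
(* This makes the logarithm of [Y] nonnegative, so that [truncn] is bounded by its argument. *)
have Y1 : 1 <= Y.
  have ge1 (x r : R) : 1 <= x -> 0 <= r -> 1 <= x `^ r.
    by move=> x1 r0; rewrite -(powRr0 x) ler_powR.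
  have h1 : 1 <= 2 `^ a by apply: ge1; rewrite ?ler1n// ltW.
  have h2 : 1 <= omega `^ (1 + p^-1).
    by apply: ge1; rewrite ?omega_ge1// addr_ge0 ?invr_ge0 ?ltW.
  by rewrite /Y; nra.
have ln2 : 0 < ln (2 : R) by rewrite ln_gt0// ltr1n.
have kY : 2 ^+ k <= Y.
  have Y0 := lt_le_trans ltr01 Y1.
  rewrite -ler_ln ?posrE// lnXn// -[ln 2 *+ k]mulr_natr mulrC -ler_pdivlMr//.
  apply: le_trans (_ : (K_p p)%:R <= _); first by rewrite ler_nat.
  by rewrite /K_p truncn_le; apply: divr_ge0; [exact: ln_ge0|exact: ltW].
apply: (@le_trans _ _ (Y `^ p)).
  apply: ge0_ler_powR; rewrite ?nnegrE//; try exact: ltW.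
  exact: le_trans ler01 Y1.
rewrite le_eqVlt; apply/orP; left; apply/eqP; have w0 := omega_gt0.
by rewrite /rec_const /Y; apply: ln_eq; [pos|pos|]; lnE; field; rewrite gt_eqF.
Qed.

(** Here [t] stands for [2^k]. The bound [r * y_p < m + 1] controls the first term and
    [m <= r * y_p] the second. *)
Lemma rec_const_step (C e t : R) (m : nat) : 0 < C -> 0 < e -> 0 < t ->
  e <= C * (rec_const * t `^ (- p)) ->
  m = truncn ((C * t / e) `^ a^-1 * y_p p) ->
  C * m.+1%:R `^ (- p) + m%:R / t * e <= C * (rec_const * (2 * t) `^ (- p)).
Proof.
move=> C0 e0 t0 eB mE; set r := (C * t / e) `^ a^-1.
have r0 : 0 < r by rewrite powR_gt0// divr_gt0// mulr_gt0.
have y0 := y_p_gt0; have w0 := omega_gt0.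
have rln : ln r = a^-1 * (ln C + ln t - ln e).
  by rewrite /r; lnE.
rewrite -/r in mE; clearbody r.
have z0 : 0 < r * y_p p by rewrite mulr_gt0.
have /andP[mz zm] : m%:R <= r * y_p p < m.+1%:R by rewrite mE truncn_itv// ltW.
have step1 : C * m.+1%:R `^ (- p) + m%:R / t * e <= C * (omega * r `^ (- p)).
  have h1 : m.+1%:R `^ (- p) <= y_p p `^ (- p) * r `^ (- p).
    by rewrite mulrC -powRM ?(ltW r0) ?(ltW y0)//; exact: ler_powRN z0 (ltW zm).
  have h2 : m%:R / t * e <= C * (y_p p * r `^ (- p)).
    (* Equivalent to [r^(p+1) = C * t / e], the definition of [r]. *)
    have -> : C * (y_p p * r `^ (- p)) = r * y_p p / t * e.
      apply: ln_eq; [pos|pos|].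
      lnE.
      rewrite rln.
      by field.
    by rewrite ler_pM2r// ler_pM2r// invr_gt0.
  have -> : C * (omega * r `^ (- p)) =
      C * (y_p p `^ (- p) * r `^ (- p)) + C * (y_p p * r `^ (- p)).
    by rewrite /omega_p; ring.
  by apply: lerD => //; rewrite ler_pM2l.
apply: (le_trans step1); rewrite ler_pM2l//.
have [s s0 sE] : exists2 s, 0 < s & s = 2 `^ p * omega.
  by exists (2 `^ p * omega) => //; pos.
(* The hypothesis on [e] solved for [r], with [s^(p+1) = rec_const]. *)
have rs : t / s <= r.
  rewrite -ler_ln ?posrE//; last by pos.
  rewrite rln; lnE; move: eB; rewrite -ler_ln ?posrE//; last by rewrite /rec_const -sE; pos.
  rewrite /rec_const -sE; lnE => eB.
  rewrite [leRHS]mulrC ler_pdivlMr//; lra.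
have ts0 : 0 < t / s by rewrite divr_gt0.
apply: (@le_trans _ _ (omega * (t / s) `^ (- p))).
  by rewrite ler_pM2l// ler_powRN.
rewrite le_eqVlt; apply/orP; left; apply/eqP.
rewrite /rec_const -sE; apply: ln_eq; [pos|pos|]; lnE.
have -> : ln s = p * ln 2 + ln omega by rewrite sE; lnE.
by ring.
Qed.

(** Replacing [t] by [4 * t] costs [4^(p+1) = 2^(2(p+1))], which together with the [2^(p(p+1))] in
    [rec_const] gives the exponent [(p+2)(p+1)]. *)
Lemma rec_const_final (N : nat) (t : R) : 0 < t -> (0 < N)%N -> N%:R <= 4 * t ->
  t^-1 * (rec_const * t `^ (- p)) <=
  2 `^ ((p + 2) * (p + 1)) * (1 + p) * (1 + p^-1) `^ p * (N%:R `^ (p + 1))^-1.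
Proof.
move=> t0 N0 Nt; have w0 := omega_gt0; have N0' : 0 < N%:R :> R by rewrite ltr0n.
rewrite -[2 `^ _ * _ * _]mulrA -omega_powR.
have -> : t^-1 * (rec_const * t `^ (- p)) = 2 `^ ((p + 2) * (p + 1)) * omega `^ a *
    ((4 * t) `^ a)^-1.
  have -> : (4 : R) = 2 * 2 by rewrite -natrM.
  by rewrite /rec_const; apply: ln_eq; [pos|pos|]; lnE; ring.
have t4 : 0 < 4 * t by rewrite mulr_gt0.
rewrite ler_pM2l ?mulr_gt0 ?powR_gt0// lef_pV2 ?posrE ?powR_gt0//.
by apply: ge0_ler_powR; rewrite ?nnegrE //; exact: ltW.
Qed.

End recursion_constants.

(** * Coordinates of the field *)

Section field_expansion.
Context {R : realType} (d : nat).
Local Notation X := (d.-tuple R).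
Local Notation nu := (@cube_measure R d).
Variables (K : X -> X -> R) (lam : nat -> R) (eta : nat -> X -> R).
Hypothesis lam_pos : forall j, 0 < lam j.
Hypothesis eta_meas : forall j, measurable_fun [set: X] (eta j).
Hypothesis K_basis : kernel_of_basis K eta.
Hypothesis K_diag_int : (cube_int (fun x => (K x x)%:E) < +oo)%E.
Hypothesis eta_eigen : forall j x, cube x ->
  cube_int (fun y => (eta j y * K x y)%:E) = (lam j * eta j x)%:E.
Hypothesis eta_L2 : forall i j, cube_int (fun x => (eta i x * eta j x)%:E)
  = (if i == j then lam j else 0)%:E.

Lemma eta_sqint j : sqint nu (eta j).
Proof.
split => //; rewrite -ge0_cube_intE//.
- rewrite (_ : (fun x => _) = fun x => (eta j x * eta j x)%:E).
    by rewrite eta_L2 ltry.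
  by apply/funext => x; rewrite expr2.
- by apply/measurable_EFinP; exact: measurable_funX.
- by move=> x; rewrite lee_fin sqr_ge0.
Qed.

Lemma ip_eta i j : ip nu (eta i) (eta j) = if i == j then lam j else 0.
Proof. by rewrite -L2dotE ?/L2dot ?eta_L2//; exact: eta_sqint. Qed.

Definition partial_diag n (x : X) : R := \sum_(j < n) eta j x ^+ 2.

Lemma measurable_partial_diag n : measurable_fun setT (partial_diag n).
Proof.
rewrite /partial_diag; apply: measurable_sum => j; exact: measurable_funX.
Qed.

Lemma partial_diag_ge0 n x : 0 <= partial_diag n x.
Proof. by apply: sumr_ge0 => j _; exact: sqr_ge0. Qed.

Lemma partial_diag_nd x : {homo partial_diag^~ x : m n / (m <= n)%N >-> m <= n}.
Proof.
apply/nondecreasing_seqP => n.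
by rewrite /partial_diag big_ord_recr/= lerDl sqr_ge0.
Qed.

Lemma integral_partial_diag n :
  (\int[nu]_x (partial_diag n x)%:E = (\sum_(j < n) lam j)%:E)%E.
Proof.
under eq_integral do rewrite /partial_diag -sumEFin.
rewrite ge0_integral_sum//; last 2 first.
- by move=> j; apply/measurable_EFinP; exact: measurable_funX.
- by move=> j x _; rewrite lee_fin sqr_ge0.
rewrite -sumEFin; apply: eq_bigr => j _.
by rewrite -EFin_ip_sqr ?ip_eta ?eqxx//; exact: eta_sqint.
Qed.

Lemma trace_kernel :
  (cube_int (fun x => (K x x)%:E) = limn (fun n => (\sum_(j < n) lam j)%:E))%E.
Proof.
(* On the cube this is the diagonal of [K]; as a limit of measurable functions it is measurable
   everywhere. *)
pose k x := limn (fun n => (partial_diag n x)%:E).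
have mp n : measurable_fun setT (fun x => (partial_diag n x)%:E).
  by apply/measurable_EFinP; exact: measurable_partial_diag.
have nd x : {homo (fun n => (partial_diag n x)%:E) : m n / (m <= n)%N >-> (m <= n)%E}.
  by move=> m n mn; rewrite lee_fin partial_diag_nd.
have p0 n x : (0 <= (partial_diag n x)%:E)%E by rewrite lee_fin partial_diag_ge0.
rewrite (@eq_cube_int _ _ _ k); last first.
  move=> x cx; apply/esym/cvg_lim => //; apply: cvg_EFin; first exact: nearW.
  exact: (cvg_kernel_diag K_basis cx).
rewrite ge0_cube_intE; last 2 first.
- apply: (emeasurable_fun_cvg (fun n x => (partial_diag n x)%:E)) => //.
  by move=> x _; exact: ereal_nondecreasing_is_cvgn.
- by move=> x; apply: lime_ge; [exact: ereal_nondecreasing_is_cvgn|exact: nearW].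
rewrite monotone_convergence//=.
by congr (limn _); apply/funext => n; exact: integral_partial_diag.
Qed.

(** [eall] is a limit in the reals, meaningful once the series converges; the finite trace
    guarantees this. *)
Lemma trace_eall : (cube_int (fun x => (K x x)%:E) = (eall lam 0)%:E)%E.
Proof.
have nd : {homo (fun n => \sum_(j < n) lam j) : m n / (m <= n)%N >-> m <= n}.
  by apply/nondecreasing_seqP => n; rewrite big_ord_recr/= lerDl ltW.
have nde : {homo (fun n => (\sum_(j < n) lam j)%:E) : m n / (m <= n)%N >-> (m <= n)%E}.
  by move=> m n mn; rewrite lee_fin nd.
have := K_diag_int; rewrite trace_kernel => finS.
have ub n : ((\sum_(j < n) lam j)%:E <= limn (fun n => (\sum_(j < n) lam j)%:E))%E.
  apply: lime_ge; first exact: ereal_nondecreasing_is_cvgn.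
  by exists n => // m /= nm; exact: nde.
set S := limn _ in finS ub *.
have Sfin : S \is a fin_num.
  rewrite fin_numElt finS andbT (lt_le_trans _ (ub 0%N))// big_ord0; exact: ltNyr.
have cv : cvgn (fun n => \sum_(j < n) lam j).
  apply: nondecreasing_is_cvgn => //; exists (fine S) => _ [n _ <-].
  by rewrite -lee_fin fineK.
rewrite /S (_ : (fun n => _) = EFin \o (fun n => \sum_(j < n) lam j))//.
rewrite EFin_lim// /eall; congr (limn _)%:E; apply/funext => n.
by rewrite big_mkord.
Qed.

Variables (dO : measure_display) (Omega : measurableType dO).
Variables (mu : probability Omega R) (F : Omega -> X -> R).
Hypothesis F_meas : measurable_fun [set: Omega * X] (fun z => F z.1 z.2).
Hypothesis F_L2 : forall w, measurable_fun [set: X] (F w) /\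
  (cube_int (fun x => (F w x ^+ 2)%:E) < +oo)%E.
Hypothesis F_gauss : centered_gaussian_field mu F K.

Lemma field_row_sqint w : sqint nu (F w).
Proof.
have [mF F2] := F_L2 w; split => //; rewrite -ge0_cube_intE//.
- by apply/measurable_EFinP; exact: measurable_funX.
- by move=> x; rewrite lee_fin sqr_ge0.
Qed.

Lemma field_sq : (\int[mu]_w \int[nu]_x (F w x ^+ 2)%:E =
  cube_int (fun x => (K x x)%:E))%E.
Proof.
have mF2 : measurable_fun setT (fun z : Omega * X => (F z.1 z.2 ^+ 2)%:E).
  by apply/measurable_EFinP; exact: measurable_funX.
have F20 (z : Omega * X) : (0 <= (F z.1 z.2 ^+ 2)%:E)%E by rewrite lee_fin sqr_ge0.
rewrite (@fubini_tonelli _ _ _ _ _ mu nu _ mF2 F20)/= -ge0_cube_intE.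
- by apply: eq_cube_int => x cx; exact: (gaussian_field_sqr K_basis F_gauss).
- exact: (@measurable_fun_fubini_tonelli_G _ _ _ _ _ mu _ mF2 F20).
- by move=> x; apply: integral_ge0 => w _; exact: (F20 (w, x)).
Qed.

Let F_sq : (\int[mu]_w \int[nu]_x (F w x ^+ 2)%:E < +oo)%E.
Proof. by rewrite field_sq. Qed.

Lemma eapp2_zero : eapp2 mu F (fun _ _ => 0) = (eall lam 0)%:E.
Proof.
rewrite -trace_eall -field_sq; apply: eq_integral => w _.
rewrite -ge0_cube_intE; last 2 first.
- by apply/measurable_EFinP; apply: measurable_funX; case: (F_L2 w).
- by move=> x; rewrite lee_fin sqr_ge0.
by congr cube_int; apply/funext => x; rewrite subr0.
Qed.

(** The [Z_j] of the overview: the coefficient of [eta j] in the orthogonal expansion of [F w]. *)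
Definition coord j w : R := (lam j)^-1 * ip nu (F w) (eta j).

Lemma coord_sqint j : sqint mu (coord j).
Proof.
apply: sqintZ; apply: sqint_field_ip => //; first exact: field_row_sqint.
exact: eta_sqint.
Qed.

(** By Fubini the expectation of [F x] times [ip nu (F w) (eta j)] is the integral of
    [K x y * eta j y] over [y], to which the eigenvalue equation applies. *)
Lemma field_coord j x : cube x -> ip mu (F ^~ x) (coord j) = eta j x.
Proof.
move=> cx; have Fx := gaussian_field_sqint K_basis F_gauss cx.
have ej := eta_sqint j; have Fr := field_row_sqint.
have Fe := sqint_field_ip F_meas Fr F_sq ej.
rewrite ipC /coord ipZl//.
suff -> : ip mu (fun w => ip nu (F w) (eta j)) (F ^~ x) = lam j * eta j x.
  by rewrite mulrA mulVf ?mul1r// gt_eqF.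
apply: EFin_inj; rewrite -eta_eigen// field_ip_col//.
rewrite -cube_intE; last exact: integrable_field_col.
apply: eq_cube_int => y cy; have Fy := gaussian_field_sqint K_basis F_gauss cy.
rewrite -(gaussian_field_cov K_basis F_gauss cx cy) -ipZl// ipC.
rewrite EFin_ip//; last exact: sqintZ.
by apply: eq_integral => w _; congr (_%:E); ring.
Qed.

Lemma field_ip_coord j h : sqint nu h ->
  ip mu (fun w => ip nu (F w) h) (coord j) = ip nu (eta j) h.
Proof.
move=> h2; have Fr := field_row_sqint; have Zj := coord_sqint j.
have ej := eta_sqint j; apply: EFin_inj.
rewrite field_ip_col// -cube_intE; last exact: integrable_field_col.
rewrite EFin_ip// -cube_intE; last exact: sqint_integrableM.
apply: eq_cube_int => x cx; have Fx := gaussian_field_sqint K_basis F_gauss cx.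
rewrite -(field_coord j cx) mulrC -ipZl// EFin_ip//; last exact: sqintZ.
by apply: eq_integral => w _; congr (_%:E); ring.
Qed.

Lemma coord_orthonormal i j : ip mu (coord i) (coord j) = (i == j)%:R.
Proof.
have Fe := sqint_field_ip F_meas field_row_sqint F_sq (eta_sqint i).
rewrite {1}/coord ipZl//; last exact: coord_sqint.
rewrite field_ip_coord ?ip_eta; last exact: eta_sqint.
by rewrite eq_sym; case: eqP => _; rewrite ?mulr0// mulVf// gt_eqF.
Qed.

Lemma node_functional_sqint T Phi : (forall t, t \in T -> cube t) ->
  node_functional T Phi -> sqint mu (fun w => Phi (F w)).
Proof.
move=> cT nPhi; under eq_fun do rewrite (node_functional_repr nPhi).
apply: sqint_sum => t; rewrite mem_undup => /cT ct.
by apply: sqintZ; exact: (gaussian_field_sqint K_basis F_gauss ct).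
Qed.

(* A finite-rank method misses the coordinate [M], so its error is positive. *)
Lemma eapp2_ge T M A : (forall t, t \in T -> cube t) ->
  node_algorithm eta T M A -> ((lam M)%:E <= eapp2 mu F A)%E.
Proof.
move=> cT [Phi [nPhi AE]].
pose D w x := F w x - \sum_(j < M) Phi j (F w) * eta j x.
have Dw w : sqint nu (D w).
  apply: sqintB; first exact: field_row_sqint.
  exact: (sqint_span eta_sqint M (fun j => Phi j (F w))).
have mD : measurable_fun setT (fun z : Omega * X => D z.1 z.2).
  apply: measurable_funB => //; apply: measurable_sum => j.
  apply: measurable_funM.
    have [mP _] := node_functional_sqint cT (nPhi j).
    exact: (measurableT_comp mP measurable_fst).
  exact: (measurableT_comp (eta_meas j) measurable_snd).
have mD2 : measurable_fun setT (fun z : Omega * X => (D z.1 z.2 ^+ 2)%:E).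
  by apply/measurable_EFinP; exact: measurable_funX.
have D20 (z : Omega * X) : (0 <= (D z.1 z.2 ^+ 2)%:E)%E by rewrite lee_fin sqr_ge0.
have -> : eapp2 mu F A = (\int[mu]_w \int[nu]_x (D w x ^+ 2)%:E)%E.
  apply: eq_integral => w _; rewrite AE -ge0_cube_intE//.
    by apply/measurable_EFinP; apply: measurable_funX; case: (Dw w).
  by move=> x; rewrite lee_fin sqr_ge0.
have ZM := coord_sqint M.
(* The coordinate has second moment 1, so it suffices to compare the integrands for each [w]. *)
have -> : (lam M)%:E = (\int[mu]_w (lam M * coord M w ^+ 2)%:E)%E.
  under eq_integral do rewrite EFinM.
  rewrite integralZl//; last exact: sqint_integrable_sqr.
  by rewrite -EFin_ip_sqr// coord_orthonormal eqxx mule1.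
apply: ge0_le_integral => //.
- by move=> w _; rewrite lee_fin mulr_ge0 ?sqr_ge0// ltW.
- apply/measurable_EFinP; apply: measurable_funM => //.
  by apply: measurable_funX; case: ZM.
- exact: (@measurable_fun_fubini_tonelli_F _ _ _ _ _ nu _ mD2 D20).
move=> w _; rewrite -EFin_ip_sqr// lee_fin.
(* The output is orthogonal to [eta M], so the residual keeps this coordinate of [F w];
   Cauchy-Schwarz against [eta M] then gives the bound. *)
have DM : ip nu (D w) (eta M) = lam M * coord M w.
  rewrite /D ipBl//; last 3 first.
  - exact: field_row_sqint.
  - exact: (sqint_span eta_sqint M (fun j => Phi j (F w))).
  - exact: eta_sqint.
  rewrite (ip_span eta_sqint M (fun j => Phi j (F w))); last exact: eta_sqint.
  rewrite big1 ?subr0; last first.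
    by move=> j _; rewrite ip_eta ltn_eqF// mulr0.
  by rewrite /coord mulrA mulfV ?mul1r// gt_eqF.
have := ip_cauchy_schwarz (Dw w) (eta_sqint M).
rewrite DM ip_eta eqxx -(ler_pM2r (lam_pos M)); have := lam_pos M; nra.
Qed.

End field_expansion.

(** * Worst case and average case errors of cubature rules *)

Section worst_case.
Context {R : realType} (d : nat).
Local Notation X := (d.-tuple R).
Local Notation nu := (@cube_measure R d).
Variables (K : X -> X -> R) (lam : nat -> R) (eta : nat -> X -> R).
Hypothesis lam_pos : forall j, 0 < lam j.
Hypothesis eta_meas : forall j, measurable_fun [set: X] (eta j).
Hypothesis K_basis : kernel_of_basis K eta.
Hypothesis K_diag_int : (cube_int (fun x => (K x x)%:E) < +oo)%E.
Hypothesis eta_eigen : forall j x, cube x ->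
  cube_int (fun y => (eta j y * K x y)%:E) = (lam j * eta j x)%:E.
Hypothesis eta_L2 : forall i j, cube_int (fun x => (eta i x * eta j x)%:E)
  = (if i == j then lam j else 0)%:E.
Let eta_si := eta_sqint eta_meas eta_L2.

Definition span_fun (c : nat -> R) n (x : X) : R := \sum_(j < n) c j * eta j x.

Lemma measurable_span_fun c n : measurable_fun setT (span_fun c n).
Proof. by have [] := sqint_span eta_si n c. Qed.

Lemma span_fun_le (c : nat -> R) n x : \sum_(j < n) c j ^+ 2 <= 1 -> cube x ->
  `|span_fun c n x| <= 1 + K x x.
Proof.
move=> c1 cx; apply: (le_trans (ler_norm_sum _ _ _)).
apply: (@le_trans _ _ (\sum_(j < n) (c j ^+ 2 + eta j x ^+ 2))).
  apply: ler_sum => j _; rewrite ler_norml.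
  by apply/andP; split; nra.
by rewrite big_split/= lerD// (kernel_diag_ge K_basis).
Qed.

(** Dominated convergence with the majorant [1 + K x x] from [span_fun_le], integrable because the
    trace is finite. *)
Lemma cvg_rint_span (c : nat -> R) (f : X -> R) : (forall n, \sum_(j < n) c j ^+ 2 <= 1) ->
  (forall x, cube x -> span_fun c n x @[n --> \oo] --> f x) ->
  rint (span_fun c n) @[n --> \oo] --> rint f.
Proof.
move=> c1 cf.
(* Convergence is known on the cube only. Multiplying by [I] makes it hold everywhere, so the limits
   are measurable, and leaves [cube_int] unchanged. *)
pose I : X -> R := \1_(@cube R d).
have mI : measurable_fun setT I.
  by apply: measurable_indic; exact: measurable_cube.
have I1 x : cube x -> I x = 1 by move=> cx; rewrite /I indicE mem_set.
have I0 x : ~ cube x -> I x = 0 by move=> cx; rewrite /I indicE memNset.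
pose s n x := (span_fun c n x * I x)%:E.
pose ft x := (f x * I x)%:E.
pose k x := ((1 + K x x) * I x)%:E.
have ms n : measurable_fun setT (s n).
  by apply/measurable_EFinP; apply: measurable_funM => //; exact: measurable_span_fun.
have sft x : s ^~ x @ \oo --> ft x.
  apply: cvg_EFin; first exact: nearW; rewrite /comp/=.
  have [cx|cx] := pselect (cube x).
    by apply: cvgM; [exact: cf|exact: cvg_cst].
  by rewrite I0// mulr0; under eq_cvg do rewrite mulr0; exact: cvg_cst.
have mft : measurable_fun setT ft.
  by apply: (emeasurable_fun_cvg s) => // x _; exact: sft.
have mk : measurable_fun setT k.
  apply: (emeasurable_fun_cvg
      (fun n x => ((1 + partial_diag eta n x) * I x)%:E)) => [n|x _].
    apply/measurable_EFinP; apply: measurable_funM => //.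
    by apply: measurable_funD => //; exact: measurable_partial_diag.
  apply: cvg_EFin; first exact: nearW; rewrite /comp/=.
  have [cx|cx] := pselect (cube x).
    apply: cvgM; last exact: cvg_cst.
    by apply: cvgD; [exact: cvg_cst|exact: (cvg_kernel_diag K_basis cx)].
  by rewrite I0// mulr0; under eq_cvg do rewrite mulr0; exact: cvg_cst.
have Kx0 x : cube x -> 0 <= K x x.
  by move=> cx; apply: le_trans (kernel_diag_ge K_basis 0 cx); rewrite big_ord0.
have k0 x : (0 <= k x)%E.
  rewrite lee_fin; have [cx|cx] := pselect (cube x).
    by rewrite I1// mulr1 addr_ge0// Kx0.
  by rewrite I0// mulr0.
have KI : nu.-integrable setT (fun x => (K x x * I x)%:E).
  have mKI : measurable_fun setT (fun x => (K x x * I x)%:E).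
    rewrite (_ : (fun x => _) = (fun x => k x - (I x)%:E)%E).
      by apply: emeasurable_funB => //; exact/measurable_EFinP.
    by apply/funext => x; rewrite /k -EFinB; congr (_%:E); ring.
  have KI0 x : (0 <= (K x x * I x)%:E)%E.
    rewrite lee_fin; have [cx|cx] := pselect (cube x).
      by rewrite I1// mulr1 Kx0.
    by rewrite I0// mulr0.
  apply/integrableP; split => //.
  rewrite (eq_integral (fun x => (K x x * I x)%:E)); last first.
    by move=> x _; rewrite gee0_abs.
  rewrite -ge0_cube_intE// (@eq_cube_int _ _ _ (fun x => (K x x)%:E))//.
  by move=> x cx; rewrite I1// mulr1.
have ki : nu.-integrable setT k.
  have i1 : nu.-integrable setT (fun x => (I x)%:E).
    by apply: integrable_indic => //; [exact: measurable_cube].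
  have := integrableD measurableT i1 KI; apply: eq_integrable => // x _.
  by rewrite /k -EFinD; congr (_%:E); ring.
have sk n x : (`|s n x| <= k x)%E.
  rewrite /s /k; have [cx|cx] := pselect (cube x).
    by rewrite I1// !mulr1 lee_fin span_fun_le.
  by rewrite I0// !mulr0 abse0.
have [fti _ cvi] := @dominated_convergence _ _ _ nu setT measurableT s ft k ms mft
  (aeW _ (fun x _ => sft x)) ki (aeW _ (fun x n _ => sk n x)).
have rE (g : X -> R) : nu.-integrable setT (fun x => (g x * I x)%:E) ->
    (\int[nu]_x (g x * I x)%:E)%E = (rint g)%:E.
  move=> gi; have e : (\int[nu]_x (g x * I x)%:E)%E = cube_int (fun x => (g x)%:E).
    by rewrite -cube_intE//; apply: eq_cube_int => x cx; rewrite I1// mulr1.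
  by rewrite /rint -e fineK// integrable_fin_num.
move: cvi; rewrite rE// => /fine_cvgP[_]; apply: cvg_trans.
apply: near_eq_cvg; apply: nearW => n /=.
rewrite rE//; apply: (@le_integrable _ _ _ nu setT measurableT _ k) => //.
  exact: (ms n).
by move=> x _; rewrite [leRHS]gee0_abs//; exact: sk.
Qed.

Variables (dO : measure_display) (Omega : measurableType dO).
Variables (mu : probability Omega R) (F : Omega -> X -> R).
Hypothesis F_meas : measurable_fun [set: Omega * X] (fun z => F z.1 z.2).
Hypothesis F_L2 : forall w, measurable_fun [set: X] (F w) /\
  (cube_int (fun x => (F w x ^+ 2)%:E) < +oo)%E.
Hypothesis F_gauss : centered_gaussian_field mu F K.

(** The infinite sum [Z] is not formed: Cauchy-Schwarz is applied to its partial sums [Z n], and [n]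
    tends to infinity in the resulting bound on [span_fun c n]. *)
Lemma worst_le_average T Q f : (forall t, t \in T -> cube t) ->
  node_functional T Q -> H_ball eta f ->
  (((rint f - Q f) ^+ 2)%:E <= eint2 mu F Q)%E.
Proof.
move=> cT nQ [c [c1 cf]].
pose q t := Q (fun x => (x == t)%:R).
have QE g : Q g = \sum_(t <- undup T) q t * g t := node_functional_repr nQ g.
have cuT t : t \in undup T -> cube t by rewrite mem_undup; exact: cT.
have Fr := field_row_sqint F_L2.
have F_sq : (\int[mu]_w \int[nu]_x (F w x ^+ 2)%:E < +oo)%E.
  by rewrite (field_sq K_basis F_meas F_gauss).
have one : sqint nu (fun=> 1) := sqint_cst nu 1.
have Zs j := coord_sqint eta_meas K_basis K_diag_int eta_L2 F_meas F_L2 F_gauss j.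
pose G w := ip nu (F w) (fun=> 1) - \sum_(t <- undup T) q t * F w t.
have Ft t : t \in undup T -> sqint mu (fun w => q t * F w t).
  by move=> /cuT ct; apply: sqintZ; exact: (gaussian_field_sqint K_basis F_gauss ct).
have IF := sqint_field_ip F_meas Fr F_sq one.
have Gs : sqint mu G by apply: sqintB => //; exact: sqint_sum.
have eintE : (eint2 mu F Q = (ip mu G G)%:E)%E.
  rewrite EFin_ip_sqr//; apply: eq_integral => w _.
  by rewrite /G -rintE// -QE.
have GZ j : ip mu G (coord lam eta F j) = rint (eta j) - Q (eta j).
  rewrite ipBl//; last exact: sqint_sum.
  rewrite (field_ip_coord lam_pos eta_meas K_basis K_diag_int eta_eigen eta_L2
    F_meas F_L2 F_gauss j one) rintE// QE; congr (_ - _).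
  rewrite ip_suml//; apply: eq_big_seq => t tT; have ct := cuT _ tT.
  rewrite ipZl//; last exact: (gaussian_field_sqint K_basis F_gauss ct).
  by rewrite (field_coord lam_pos eta_meas K_basis K_diag_int eta_eigen eta_L2
    F_meas F_L2 F_gauss j ct).
pose Z n w := \sum_(j < n) c j * coord lam eta F j w.
have Zns n : sqint mu (Z n) by apply: sqint_sum => j _; exact: sqintZ.
have GZn n : ip mu G (Z n) = rint (span_fun c n) - Q (span_fun c n).
  rewrite ipC ip_suml//; last by move=> j _; exact: sqintZ.
  rewrite rintE; last exact: (sqint_span eta_si n c).
  rewrite (ip_span eta_si n c)// QE.
  under [X in _ - X]eq_bigr do rewrite /span_fun mulr_sumr.
  rewrite exchange_big/= -sumrB; apply: eq_bigr => j _.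
  rewrite ipZl// ipC GZ rintE// QE mulrBr; congr (_ - _).
  by rewrite mulr_sumr; apply: eq_bigr => t _; ring.
(* By orthonormality the left side is the sum of the first [n] squares [c j ^+ 2]. *)
have ZZ n : ip mu (Z n) (Z n) <= 1.
  rewrite {1}/Z ip_suml//; last by move=> j _; exact: sqintZ.
  apply: le_trans (c1 n); rewrite le_eqVlt; apply/orP; left; apply/eqP.
  apply: eq_bigr => j _; rewrite ipZl// ipC ip_suml//; last first.
    by move=> i _; exact: sqintZ.
  rewrite (bigD1 j)//= big1 ?addr0 => [|i ij].
    rewrite ipZl// (coord_orthonormal lam_pos eta_meas K_basis K_diag_int eta_eigen
      eta_L2 F_meas F_L2 F_gauss) eqxx mulr1 expr2//.
  rewrite ipZl// (coord_orthonormal lam_pos eta_meas K_basis K_diag_int eta_eigen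
    eta_L2 F_meas F_L2 F_gauss) (_ : (i == j :> nat) = false) ?mulr0//.
  exact: negbTE ij.
have bound n : (rint (span_fun c n) - Q (span_fun c n)) ^+ 2 <= ip mu G G.
  rewrite -GZn; apply: (le_trans (ip_cauchy_schwarz Gs (Zns n))).
  by rewrite ler_piMr ?ip_ge0.
(* [Q] is a finite combination of values at nodes in the cube, where the partial sums converge. *)
have cvQ : Q (span_fun c n) @[n --> \oo] --> Q f.
  have cvs s : (forall t, t \in s -> cube t) ->
      (fun n => \sum_(t <- s) q t * span_fun c n t) @ \oo --> \sum_(t <- s) q t * f t.
    elim: s => [|t s ih] cs.
      rewrite big_nil (_ : (fun n => _) = fun=> 0); first exact: cvg_cst.
      by apply/funext => n; rewrite big_nil.
    rewrite big_cons (_ : (fun n => _) = (fun n => q t * span_fun c n t +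
      \sum_(u <- s) q u * span_fun c n u)); last first.
      by apply/funext => n; rewrite big_cons.
    apply: cvgD; last by apply: ih => u us; apply: cs; rewrite in_cons us orbT.
    by apply: cvgM; [exact: cvg_cst|apply: cf; apply: cs; rewrite mem_head].
  rewrite QE (_ : (fun n => _) = fun n => \sum_(t <- undup T) q t * span_fun c n t).
    exact: cvs.
  by apply/funext => n; exact: QE.
have cvL : (rint (span_fun c n) - Q (span_fun c n)) ^+ 2 @[n --> \oo]
    --> (rint f - Q f) ^+ 2.
  have h : rint (span_fun c n) - Q (span_fun c n) @[n --> \oo] --> rint f - Q f.
    by apply: cvgB; [exact: cvg_rint_span|exact: cvQ].
  by apply: cvgM; exact: h.
rewrite eintE lee_fin -(cvg_lim _ cvL)//; apply: limr_le; last exact: nearW.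
by apply/cvg_ex; eexists; exact: cvL.
Qed.

Lemma ewor_sqr_le T Q (B : R) : (forall t, t \in T -> cube t) ->
  node_functional T Q -> (eint2 mu F Q <= B%:E)%E ->
  (ewor eta Q * ewor eta Q <= B%:E)%E.
Proof.
move=> cT nQ QB.
(* The zero function shows that [B] and [ewor eta Q] are nonnegative, as taking the root and
   multiplying the bounds require. *)
have H0 : H_ball eta (fun=> 0).
  exists (fun=> 0); split => [n|x _].
    by rewrite big1 ?ler01// => j _; rewrite expr0n.
  rewrite (_ : (fun n => _) = (fun=> 0)); first exact: cvg_cst.
  by apply/funext => n; rewrite big1// => j _; rewrite mul0r.
have B0 : 0 <= B.
  have := le_trans (worst_le_average cT nQ H0) QB; rewrite lee_fin.
  exact/le_trans/sqr_ge0.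
have wle : (ewor eta Q <= (Num.sqrt B)%:E)%E.
  apply: ge_ereal_sup => _ [f Hf <-]; rewrite lee_fin -sqrtr_sqr ler_wsqrtr//.
  by rewrite -lee_fin (le_trans (worst_le_average cT nQ Hf)).
have w0 : (0 <= ewor eta Q)%E.
  apply: le_trans (ereal_sup_ubound _); last by exists (fun=> 0).
  by rewrite lee_fin.
apply: (le_trans (lee_pmul _ _ wle wle)) => //.
by rewrite -EFinM lee_fin -expr2 sqr_sqrtr.
Qed.

End worst_case.

(** * The cubature rule *)

Lemma Alg_eq0 {R : realType} (d : nat) (dO : measure_display)
  (Omega : measurableType dO) (mu : probability Omega R)
  (F : Omega -> d.-tuple R -> R) lam eta (C p : R) P k :
  (k <= K_p p)%N -> Alg mu F lam eta C p P k = fun _ _ => 0.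
Proof. by case: k => //= k kK; rewrite kK. Qed.

Unset Implicit Arguments. Set Strict Implicit. Set Printing Implicit Defensive.

Theorem theorem5p8 (R : realType) (d : nat) (hd : (0 < d)%N)
  (* the reproducing kernel and the eigenpairs (0-indexed: lam j = lambda_{d,j+1}) *)
  (K : d.-tuple R -> d.-tuple R -> R)
  (lam : nat -> R) (eta : nat -> d.-tuple R -> R)
  (lam_pos : forall j, 0 < lam j)
  (lam_noninc : forall j, lam j.+1 <= lam j)
  (eta_meas : forall j, measurable_fun [set: d.-tuple R] (eta j))
  (* (eta_j) is an orthonormal basis of H_d and K is its reproducing kernel *)
  (K_basis : kernel_of_basis K eta)
  (* M_{2,d} < oo *)
  (K_diag_int : (cube_int (fun x => (K x x)%:E) < +oo)%E)
  (* W_d eta_j = lambda_{d,j} eta_j *)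
  (eta_eigen : forall j x, cube x ->
     cube_int (fun y => (eta j y * K x y)%:E) = (lam j * eta j x)%:E)
  (* orthogonality in L_2 with ||eta_j||^2 = lambda_{d,j} *)
  (eta_L2 : forall i j,
     cube_int (fun x => (eta i x * eta j x)%:E)
     = (if i == j then lam j else 0)%:E)
  (* the Gaussian measure mu_d, as the law of a random field F *)
  (dO : measure_display) (Omega : measurableType dO) (mu : probability Omega R)
  (F : Omega -> d.-tuple R -> R)
  (F_meas : measurable_fun [set: Omega * d.-tuple R] (fun z => F z.1 z.2))
  (F_L2 : forall w, measurable_fun [set: d.-tuple R] (F w) /\
                    (cube_int (fun x => (F w x ^+ 2)%:E) < +oo)%E)
  (F_gauss : centered_gaussian_field mu F K)
  (* the Assumption *)
  (C p : R) (C_pos : 0 < C) (p_pos : 0 < p)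
  (Hassump : forall m : nat, eall lam m <= C * (m.+1%:R) `^ (- p))
  (* the number of nodes *)
  (N : nat) (hN : (2 <= N)%N)
  (* the point sets P_k (K_p < k <= kappa) satisfying the bound of (i) *)
  (P : nat -> seq (d.-tuple R))
  (HP : forall k : nat, (K_p p < k <= kappa N)%N ->
     [/\ size (P k) = (2 ^ k.-1)%N,
         (forall t, t \in P k -> cube t) &
         (eapp2 mu F (Alg mu F lam eta C p P k)
          <= (eall lam (m_k C p (eapp2 mu F (Alg mu F lam eta C p P k.-1)) k.-1))%:E
             + ((m_k C p (eapp2 mu F (Alg mu F lam eta C p P k.-1)) k.-1)%:R
                / (2 ^+ k.-1))%:E
               * eapp2 mu F (Alg mu F lam eta C p P k.-1))%E])
  (* the point set P^int satisfying the bound of (ii) *)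
  (Pint : seq (d.-tuple R))
  (HPint_size : size Pint = (2 ^ kappa N)%N)
  (HPint_cube : forall t, t \in Pint -> cube t)
  (HPint : (eint2 mu F (Q_N mu F lam eta C p P Pint N)
            <= ((2 ^+ kappa N)^-1)%:E
               * eapp2 mu F (Alg mu F lam eta C p P (kappa N)))%E) :
  (* Q_{d,N} uses at most N integration nodes *)
  (exists nodes : seq (d.-tuple R),
      [/\ (size nodes <= N)%N,
          (forall t, t \in nodes -> cube t) &
          forall f g : d.-tuple R -> R,
            (forall t, t \in nodes -> f t = g t) ->
            Q_N mu F lam eta C p P Pint N f = Q_N mu F lam eta C p P Pint N g])
  /\
  (ewor eta (Q_N mu F lam eta C p P Pint N)
     * ewor eta (Q_N mu F lam eta C p P Pint N)
   <= (2 `^ ((p + 2) * (p + 1)) * (1 + p) * (1 + p^-1) `^ p * C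
       * (N%:R `^ (p + 1))^-1)%:E)%E.
Proof.
have HP' k : (K_p p < k <= kappa N)%N ->
    size (P k) = (2 ^ k.-1)%N /\ (forall t, t \in P k -> cube t).
  by move=> /HP[].
have eta_si := eta_sqint eta_meas eta_L2.
(* As [N >= 2], the predecessor in [kappa] is not truncated, and [2^(kappa + 1)] is the largest
   power of 2 not exceeding [N]. *)
have log_gt0 : (0 < trunc_log 2 N)%N by rewrite trunc_log_gt0.
have kS : (kappa N).+1 = trunc_log 2 N by rewrite /kappa prednK.
have [T [M [sT cT nA]]] :=
  node_algorithm_Alg lam eta_si mu F C HP' (leqnn (kappa N)).
have nQ := node_functional_cubQ eta_si Pint nA.
have cTP t : t \in T ++ Pint -> cube t.
  by rewrite mem_cat => /orP[/cT|/HPint_cube].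
split.
  exists (T ++ Pint); split => //; last by case: nQ.
  have N0 : (0 < N)%N by exact: ltnW.
  apply: leq_trans (trunc_logP (ltnSn 1) N0).
  by rewrite -kS size_cat HPint_size expnS mul2n -addnn leq_add2r.
have zero_bound k : (k <= K_p p)%N ->
    ((eall lam 0)%:E <= (C * (rec_const p * (2 ^+ k) `^ (- p)))%:E)%E.
  move=> kK; rewrite lee_fin; apply: (le_trans (Hassump 0%N)).
  by rewrite ler_pM2l// powR1; exact: rec_const_base.
have app_bound k : (k <= kappa N)%N ->
    (eapp2 mu F (Alg mu F lam eta C p P k) <=
     (C * (rec_const p * (2 ^+ k) `^ (- p)))%:E)%E.
  elim: k => [|k ih] kN.
    rewrite Alg_eq0// (eapp2_zero lam_pos eta_meas K_basis K_diag_int eta_L2 F_meas F_L2 F_gauss).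
    exact: zero_bound.
  have [kK|Kk] := leqP k.+1 (K_p p).
    rewrite Alg_eq0// (eapp2_zero lam_pos eta_meas K_basis K_diag_int eta_L2 F_meas F_L2 F_gauss).
    exact: zero_bound.
  have [|_ _] := HP k.+1; first by rewrite Kk.
  rewrite [k.+1.-1]/=.
  have [T' [M' [_ cT' nA']]] := node_algorithm_Alg lam eta_si mu F C HP' (ltnW kN).
  (* This lower bound makes the previous error positive, while the induction hypothesis makes it
     finite; so [fine] in [m_k] returns the true error. *)
  have eM := eapp2_ge lam_pos eta_meas K_basis K_diag_int eta_eigen eta_L2
    F_meas F_L2 F_gauss cT' nA'.
  have := ih (ltnW kN); move: eM.
  case: (eapp2 mu F (Alg mu F lam eta C p P k)) => [e| |]//.
  rewrite !lee_fin => eM eB.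
  set m := m_k C p e%:E k => h; apply: (le_trans h).
  have e0 : 0 < e by exact: lt_le_trans eM.
  have t0 : 0 < 2 ^+ k :> R by rewrite exprn_gt0.
  rewrite -EFinM -EFinD lee_fin exprS.
  have := rec_const_step p_pos C_pos e0 t0 eB (erefl m); apply: le_trans.
  by rewrite lerD2r Hassump.
apply: (ewor_sqr_le lam_pos eta_meas K_basis K_diag_int eta_eigen eta_L2
  F_meas F_L2 F_gauss cTP nQ).
apply: (le_trans HPint).
have t0 : 0 < 2 ^+ kappa N :> R by rewrite exprn_gt0.
apply: (le_trans (lee_wpmul2l _ (app_bound _ (leqnn _)))).
  by rewrite lee_fin invr_ge0 ltW.
rewrite -EFinM lee_fin mulrCA.
(* The right side is [2^(trunc_log 2 N + 1)], which exceeds [N]. *)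
have NN : N%:R <= 4 * 2 ^+ kappa N :> R.
  have -> : (4 : R) = 2 ^+ 2 by rewrite -natrX.
  rewrite -exprD -natrX ler_nat add2n kS; apply: ltnW.
  exact: trunc_log_ltn.
have := rec_const_final p_pos t0 (ltnW hN) NN.
move=> /(ler_wpM2l (ltW C_pos)) /le_trans; apply.
by rewrite mulrA (mulrC C).
Qed.
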